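(* Let $N\ge 1$, let $p=(p_1,\ldots,p_N)$ with each $p_k\in(0,1)$, and put $p^{-1}=(p_1^{-1},\ldots,p_N^{-1})$, $\pi=(\pi_1,\ldots,\pi_N)$ with $\pi_k=p_k/(1-p_k)$, and $\pi^{-1}=(\pi_1^{-1},\ldots,\pi_N^{-1})$. For each of the four Markov chains $Y=(Y(n);n\ge 0)$ (Cases A, B, C, D) defined in the context, the $n$-step transition kernel $Q_n(y,y')=\mathbf P(Y(n)=y'\mid Y(0)=y)$, $n\ge 0$, is given as follows (all determinants are of $N\times N$ matrices with $(i,j)$ entry as displayed, $1\le i,j\le N$). Case A (geometric jumps with pushing): for $y,y'\in\hat W^N$, $$Q_n(y,y')=\prod_{k=1}^N\left[(1-p_k)^n p_k^{y_k'-y_k}\right]\det\left\{\hat w^{(ij)}_{n,p^{-1}}(y'_i-y_j+i-j)\right\}.$$ Case B (Bernoulli jumps with blocking): for $y,y'\in W^N$, $$Q_n(y,y')=\prod_{k=1}^N\left[(1-p_k)^n \pi_k^{y_k'-y_k}\right]\det\left\{v^{(ij)}_{n,\pi}(y'_i-y_j-i+j)\right\}.$$ Case C (geometric jumps with blocking): for $y,y'\in W^N$, $$Q_n(y,y')=\prod_{k=1}^N\left[(1-p_k)^n p_k^{y_k'-y_k}\right]\det\left\{w^{(ij)}_{n,p}(y'_i-y_j-i+j)\right\}.$$ Case D (Bernoulli jumps with pushing): for $y,y'\in\hat W^N$, $$Q_n(y,y')=\prod_{k=1}^N\left[(1-p_k)^n \pi_k^{y_k'-y_k}\right]\det\left\{\hat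 v^{(ij)}_{n,\pi^{-1}}(y'_i-y_j+i-j)\right\}.$$
   Context: State spaces: $W^N=\{z\in\mathbf Z^N: z_N\le z_{N-1}\le\cdots\le z_1\}$ and $\hat W^N=\{z\in\mathbf Z^N: z_1\le z_2\le\cdots\le z_N\}$. The four processes. Let $(\xi(k,n);\,1\le k\le N,\ n\ge 1)$ be independent random variables. ''Geometric'' means $\mathbf P(\xi(k,n)=r)=(1-p_k)p_k^r$ for $r=0,1,2,\ldots$; ''Bernoulli'' means $\mathbf P(\xi(k,n)=1)=p_k=1-\mathbf P(\xi(k,n)=0)$. In every case $Y_1(n)=Y_1(n-1)+\xi(1,n)$, and for $k=2,\ldots,N$: - Case A ($\xi$ geometric, $Y$ takes values in $\hat W^N$): $Y_k(n)=\max(Y_k(n-1),Y_{k-1}(n))+\xi(k,n)$. - Case B ($\xi$ Bernoulli, $Y$ takes values in $W^N$): $Y_k(n)=\min(Y_k(n-1)+\xi(k,n),\,Y_{k-1}(n))$. - Case C ($\xi$ geometric, $Y$ takes values in $W^N$): $Y_k(n)=\min(Y_k(n-1)+\xi(k,n),\,Y_{k-1}(n-1))$. - Case D ($\xi$ Bernoulli, $Y$ takes values in $\hat W^N$): $Y_k(n)=\max(Y_k(n-1)+\xi(k,n),\,Y_{k-1}(n))$. Symmetric functions. For a vector $\alpha=(\alpha_1,\ldots,\alpha_N)$ and $i\le j$, $h^{(ij)}_r(\alpha)$ and $e^{(ij)}_r(\alpha)$ denote respectively the $r$th complete homogeneous and the $r$th elementary symmetric polynomial in the variables $\alpha_{i+1},\ldots,\alpha_j$,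 with $h^{(ij)}_0=e^{(ij)}_0=1$, $h^{(ij)}_r=e^{(ij)}_r=0$ for $r<0$, and $h^{(jj)}_r(\alpha)=e^{(jj)}_r(\alpha)=\mathbf 1(r=0)$. For a function $f$ on $\mathbf Z$, $\alpha\in\mathbf R_+^N$, $1\le i,j\le N$ and $k\in\mathbf Z$ (whenever the series converge absolutely, which is the case for all functions used here): $$f^{(ij)}_\alpha(k)=\begin{cases}\sum_{\ell=0}^{i-j}(-1)^\ell e^{(ji)}_\ell(\alpha) f(k+\ell)& j\le i,\\ \sum_{\ell=0}^\infty h^{(ij)}_\ell(\alpha) f(k+\ell)& i\le j,\end{cases}\qquad \hat f^{(ij)}_\alpha(k)=\begin{cases}\sum_{\ell=0}^{i-j}(-1)^\ell e^{(ji)}_\ell(\alpha) f(k-\ell)& j\le i,\\ \sum_{\ell=0}^\infty h^{(ij)}_\ell(\alpha) f(k-\ell)& i\le j.\end{cases}$$ The functions used: $w_n(k)=\binom{n-1+k}{k}\mathbf 1(k\ge 0;\,n\ge 0)$ (so $w_0(k)=\mathbf 1(k=0)$) and $v_n(k)=\binom nk\mathbf 1(0\le k\le n;\,n\ge 0)$. One writes $w^{(ij)}_{n,\alpha}$ and $\hat w^{(ij)}_{n,\alpha}$ for $f^{(ij)}_\alpha$ and $\hat f^{(ij)}_\alpha$ with $f=w_n$, and $v^{(ij)}_{n,\alpha}$, $\hat v^{(ij)}_{n,\alpha}$ for the same with $f=v_n$. *)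

(* Defs.v *)
From HB Require Import structures.
From mathcomp Require Import all_boot all_order all_algebra.
From mathcomp Require Import finmap.
From mathcomp Require Import all_classical all_reals all_analysis.

Set Implicit Arguments.
Unset Strict Implicit.
Unset Printing Implicit Defensive.

Import Order.TTheory GRing.Theory Num.Theory.
Import numFieldNormedType.Exports.

Local Open Scope classical_set_scope.
Local Open Scope ring_scope.

(** Coordinates are indexed by ['I_N], i.e. from [0] to [N - 1] instead of from
    [1] to [N]. Only differences and comparisons of indices occur below, so no
    formula is affected by the shift. *)
Definition state (N : nat) := {ffun 'I_N -> int}.

Definition W (N : nat) (z : state N) : Prop :=
  forall j k : 'I_N, (j <= k)%N -> z k <= z j.

Definition What (N : nat) (z : state N) : Prop :=
  forall j k : 'I_N, (j <= k)%N -> z j <= z k.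

Section Dynamics.
Variable N : nat.

(** One time step: [u] is the noise [k |-> xi(k, n)], [x] is [Y(n-1)] and [z] is
    [Y(n)]; [j] is the predecessor of [k]. *)
Definition step_type := ('I_N -> nat) -> state N -> state N -> Prop.

Definition step_first (u : 'I_N -> nat) (x z : state N) : Prop :=
  forall k : 'I_N, k = 0%N :> nat -> z k = x k + (u k)%:Z.

Definition stepA : step_type := fun u x z => step_first u x z /\
  forall j k : 'I_N, k = j.+1 :> nat -> z k = Num.max (x k) (z j) + (u k)%:Z.

Definition stepB : step_type := fun u x z => step_first u x z /\
  forall j k : 'I_N, k = j.+1 :> nat -> z k = Num.min (x k + (u k)%:Z) (z j).

Definition stepC : step_type := fun u x z => step_first u x z /\
  forall j k : 'I_N, k = j.+1 :> nat -> z k = Num.min (x k + (u k)%:Z) (x j).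

Definition stepD : step_type := fun u x z => step_first u x z /\
  forall j k : 'I_N, k = j.+1 :> nat -> z k = Num.max (x k + (u k)%:Z) (z j).

End Dynamics.

Section Probability.
Context d (T : measurableType d) (R : realType) (P : probability T R).

Definition mutually_independent (I : choiceType) (D : set I)
    (F : I -> set (set T)) : Prop :=
  forall J : {fset I}, [set` J] `<=` D ->
  forall A : I -> set T, (forall i, i \in J -> F i (A i)) ->
  P (\bigcap_(i in [set` J]) A i) = (\prod_(i <- J) P (A i))%E.

(** The sigma-algebra generated by a map into a countable discrete space. *)
Definition discrete_sigma (U : Type) (X : T -> U) : set (set T) :=
  preimage_set_system [set: T] X [set: set U].

Definition cond_prob (A B : set T) : R := fine (P (A `&` B)) / fine (P B).

Variable N : nat.

Definition geometric_noise (p : 'I_N -> R) (xi : 'I_N -> nat -> {RV P >-> nat})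
    : Prop :=
  forall k n, (1 <= n)%N ->
  forall r : nat, P [set t | xi k n t = r] = ((1 - p k) * p k ^+ r)%:E.

Definition bernoulli_noise (p : 'I_N -> R) (xi : 'I_N -> nat -> {RV P >-> nat})
    : Prop :=
  forall k n, (1 <= n)%N ->
  P [set t | xi k n t = 1%N] = (p k)%:E /\
  P [set t | xi k n t = 0%N] = (1 - p k)%:E.

(** [Y] is the chain with state space [S] driven by [xi] through [step]. The
    initial state may be random; it is independent of the noise. In the index
    type of the independent family, [None] stands for [Y 0] and [Some (k, n)],
    [n >= 1], for [xi k n]. *)
Definition is_chain (S : state N -> Prop) (step : step_type N)
    (xi : 'I_N -> nat -> {RV P >-> nat}) (Y : nat -> T -> state N) : Prop :=
  [/\ forall t, S (Y 0%N t),
      discrete_sigma (Y 0%N) `<=` measurable,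
      mutually_independent
        [set i : option ('I_N * nat) | if i is Some (_, n) then (1 <= n)%N : Prop
                                       else True]
        (fun i => if i is Some (k, n) then discrete_sigma (xi k n)
                  else discrete_sigma (Y 0%N)) &
      forall n t, step (fun k => xi k n.+1 t) (Y n t) (Y n.+1 t)].

Definition transition (Y : nat -> T -> state N) (n : nat) (y y' : state N) : R :=
  cond_prob [set t | Y n t = y'] [set t | Y 0%N t = y].

End Probability.

Section SymmetricFunctions.
Context (R : realType) (N : nat).
Implicit Types (a : 'I_N -> R) (i j : 'I_N).

(** Elementary symmetric polynomial in the variables [a k], [i < k <= j]: sum
    over the [r]-element sets of variables. *)
Definition esym i j a (r : nat) : R :=
  \sum_(A : {set 'I_N} | (A \subset [set k : 'I_N | (i < k <= j)%N]%SET)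
                         && (#|A| == r))
    \prod_(k in A) a k.

(** Complete homogeneous symmetric polynomial in the same variables: sum over
    all exponents [m] of total degree [r] (each exponent is then at most [r]). *)
Definition hsym i j a (r : nat) : R :=
  \sum_(m : {ffun 'I_N -> 'I_r.+1} |
          [forall k : 'I_N, ~~ (i < k <= j)%N ==> (m k == 0%N :> nat)]
          && (\sum_(k < N) m k == r)%N)
    \prod_(k < N) a k ^+ m k.

(** For [i = j] both branches give [f k]. The series converge absolutely for the
    functions used; on divergent ones [limn] is an unspecified value. *)
Definition transf (f : int -> R) a i j (k : int) : R :=
  if (j <= i)%N then
    \sum_(0 <= l < (i - j).+1) (-1) ^+ l * esym j i a l * f (k + l%:Z)
  else limn [series hsym i j a l * f (k + l%:Z)]_l.

Definition transhat (f : int -> R) a i j (k : int) : R :=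
  if (j <= i)%N then
    \sum_(0 <= l < (i - j).+1) (-1) ^+ l * esym j i a l * f (k - l%:Z)
  else limn [series hsym i j a l * f (k - l%:Z)]_l.

End SymmetricFunctions.

(** For [n = 0] and [m = 0] the truncated predecessor gives ['C(0, 0) = 1], and
    for [n = 0] and [m > 0] one gets ['C(m - 1, m) = 0]. *)
Definition wfun (R : realType) (n : nat) (k : int) : R :=
  if k is Posz m then 'C((n + m).-1, m)%:R else 0.

Definition vfun (R : realType) (n : nat) (k : int) : R :=
  if k is Posz m then 'C(n, m)%:R else 0.

(* Main.v *)
(** With phi_i(u) = (1 - a_1/u) ... (1 - a_i/u), the (i, j) entry built from a
    function f is the coefficient of u^k in F(u) phi_i(u) / phi_j(u), where F is
    the generating function of f.  Moving i or j by one multiplies an entry by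
    1 - a/u, and moving n by one multiplies it by 1/(1 - u) or by 1 + u.

    Blocking (B, C) satisfies the determinantal formula through the backward
    equation, pushing (A, D) through the forward equation.  In either case the
    weights of one step have the form prod_k w_k(z_{k-1}, z_k), so that z_N, ...,
    z_1 can be summed out one after the other, each sum acting on a single row or
    column of the determinant.  Summing out z_k yields the wanted line for time
    n + 1, plus a multiple of the neighbouring line for time n + 1 (harmless once
    everything is summed) and a multiple of the neighbouring line at z_{k-1}
    (harmless at once).  For n = 0 the matrix is unitriangular if y = y' and
    otherwise has a zero block that forces its determinant to vanish. *)
Require Import Defs.
From HB Require Import structures.
From mathcomp Require Import all_boot all_order all_algebra finmap.
From mathcomp Require Import all_classical all_reals all_analysis.
From mathcomp Require Import perm ring lra zify.

Set Implicit Arguments.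
Unset Strict Implicit.
Unset Printing Implicit Defensive.

Import Order.TTheory GRing.Theory Num.Theory.
Import numFieldNormedType.Exports.

Local Open Scope classical_set_scope.
Local Open Scope ring_scope.

(** No coordinate ever decreases, so a path from y to y' stays between the two states and the kernel
    is a power of a matrix indexed by a finite box of states. The Markov property is derived from
    the independence of the noise. The interaction dictates the direction of each equation. With the
    target of a pushing step fixed, the weight of coordinate k involves only its own earlier
    position, and the earlier positions are coupled by their ordering alone. With the start of a
    blocking step fixed, coordinate k is coupled to the other new positions only through that of
    coordinate k - 1. The edge of the box is delicate: a truncated sum has the right value only if
    the lines vanish at the edge or no mass crosses it. Hence the margin N below y for pushing and n
    above y in case B. The entry series have infinitely many nonzero terms only in case C, where
    convergence must be proved: in A and D the argument k - l turns negative, and in B the function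
    v_n has bounded support. *)

Definition pred_ord N (k : 'I_N) : 'I_N :=
  Ordinal (leq_ltn_trans (leq_pred k) (ltn_ord k)).

(** * Determinants as functions of their rows *)

Section RowDeterminant.
Context (R : comNzRingType) (N : nat).
Implicit Types (f : 'I_N -> 'rV[R]_N) (k : 'I_N) (u v : 'rV[R]_N).

Definition det_rows f : R := \det (\matrix_k f k).

Definition set_row f k v : 'I_N -> 'rV[R]_N := fun i => if i == k then v else f i.

Lemma eq_det_rows f g : f =1 g -> det_rows f = det_rows g.
Proof.
by move=> fg; rewrite /det_rows; congr (\det _); apply/row_matrixP => i; rewrite !rowK fg.
Qed.

Lemma det_set_row_linear f k b c u v :
  det_rows (set_row f k (b *: u + c *: v)) =
  b * det_rows (set_row f k u) + c * det_rows (set_row f k v).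
Proof.
apply: (@determinant_multilinear _ _ _ _ _ k).
- by rewrite !rowK /set_row eqxx.
all: by apply/row_matrixP => i; apply/rowP => j;
  rewrite !mxE /set_row eq_sym (negPf (neq_lift _ _)).
Qed.

Lemma det_set_row0 f k : det_rows (set_row f k 0) = 0.
Proof.
have := det_set_row_linear f k 0 0 0 0.
by rewrite !scale0r addr0 !mul0r addr0.
Qed.

Lemma det_set_row_sum (J : finType) f k (b : J -> R) (v : J -> 'rV[R]_N) :
  det_rows (set_row f k (\sum_s b s *: v s)) =
  \sum_s b s * det_rows (set_row f k (v s)).
Proof.
elim: (index_enum J) => [|s l IH]; first by rewrite !big_nil det_set_row0.
by rewrite !big_cons -[X in _ + X]scale1r det_set_row_linear mul1r IH.
Qed.

Lemma det_set_row_copy f i k : i != k -> det_rows (set_row f k (f i)) = 0.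
Proof.
move=> ik; apply: (determinant_alternate ik) => j.
by rewrite !mxE /set_row (negPf ik) eqxx.
Qed.

End RowDeterminant.

(** * Summing a chain of weights against a determinant *)

Section Sweep.
Context (R : comNzRingType) (N : nat) (J : finType).
(** [w k t s] weighs position [s] of coordinate [k] when coordinate [k - 1] is at [t]; [V k s] is
    the determinant line at [s], and [U k] the line wanted after summation. Weight never leads from
    [ok] positions to others, so the identity [w_sum] is asked only for [ok] predecessors. *)
Variables (w : 'I_N -> J -> J -> R) (V : 'I_N -> J -> 'rV[R]_N).
Variables (U : 'I_N -> 'rV[R]_N) (a c : 'I_N -> R) (c' : 'I_N -> J -> R).
Variable ok : 'I_N -> J -> bool.

(** The new family is a unit lower bidiagonal matrix times the old one. At [k = 0], where
    [pred_ord k] is [k] itself, the factor [(0 < k)%N%:R] removes the extra term. *)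
Lemma det_rows_add_pred :
  det_rows (fun k => U k + (0 < k)%N%:R *: (c k *: U (pred_ord k))) = det_rows U.
Proof.
pose L : 'M[R]_N := \matrix_(i, j) ((i == j)%:R + ((0 < i)%N && (j == pred_ord i))%:R * c i).
have -> : det_rows (fun k => U k + (0 < k)%N%:R *: (c k *: U (pred_ord k)))
    = \det (L *m \matrix_k U k).
  congr (\det _); apply/row_matrixP => i; rewrite row_mul rowK.
  rewrite mulmx_sum_row.
  under eq_bigr => j _ do rewrite !mxE scalerDl rowK.
  rewrite big_split /= (bigD1 i) //= eqxx scale1r big1 ?addr0; last first.
    by move=> j ji; rewrite eq_sym (negPf ji) scale0r.
  congr (_ + _); rewrite (bigD1 (pred_ord i)) //= eqxx andbT big1 ?addr0.
    by rewrite scalerA.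
  by move=> j ji; rewrite (negPf ji) andbF mul0r scale0r.
rewrite det_mulmx det_trig ?big1 ?mul1r //.
  move=> i _; rewrite mxE eqxx (_ : (_ && _) = false) ?mul0r ?addr0 //.
  by apply/negP => /andP[i0 /eqP/(congr1 val)/= E]; have := prednK i0; rewrite -E => /eqP;
    rewrite (gtn_eqF (ltnSn _)).
apply/is_trig_mxP => i j ij; rewrite mxE (_ : (i == j) = false) ?add0r; last first.
  by apply/negP => /eqP E; rewrite E ltnn in ij.
rewrite (_ : (_ && _) = false) ?mul0r //.
apply/negP => /andP[i0 /eqP E]; move: ij; rewrite E /= => ij.
by have := leq_trans ij (leq_pred i); rewrite ltnn.
Qed.

Hypothesis w_first : forall (k : 'I_N) t t' s, k = 0%N :> nat -> w k t s = w k t' s.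
Hypothesis w_ok : forall (k : 'I_N) t s, ((0 < k)%N -> ok (pred_ord k) t) ->
  ~~ ok k s -> w k t s = 0.
Hypothesis w_sum : forall (k : 'I_N) t, ((0 < k)%N -> ok (pred_ord k) t) ->
  \sum_s w k t s *: V k s = a k *: (U k + (0 < k)%N%:R *:
    (c k *: U (pred_ord k) + c' k t *: V (pred_ord k) t)).

Let upd (z : {ffun 'I_N -> J}) (m : 'I_N) s : {ffun 'I_N -> J} :=
  [ffun k => if k == m then s else z k].

(** Coordinates already summed out are frozen at [s0], so all partial sums run over one function
    type; releasing coordinate [m] is a bijection with pairs of a frozen function and a value. *)
Let supp s0 m (z : {ffun 'I_N -> J}) :=
  [forall k : 'I_N, (m <= k)%N ==> (z k == s0)].

Let supp_split s0 (m : 'I_N) (F : {ffun 'I_N -> J} -> R) :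
  \sum_(z | supp s0 m.+1 z) F z = \sum_(z | supp s0 m z) \sum_s F (upd z m s).
Proof.
rewrite pair_big_dep /= (reindex_onto (fun x : {ffun 'I_N -> J} * J => upd x.1 m x.2)
    (fun z => (upd z m s0, z m))) /=; last first.
  by move=> z _; apply/ffunP => k; rewrite !ffunE; case: eqP => // ->.
apply: eq_bigl => -[z s]; rewrite andbT /= xpair_eqE; apply/andP/idP.
  case=> /forallP H /andP[/eqP E _]; apply/forallP => k; apply/implyP.
  rewrite leq_eqVlt => /orP[/eqP/val_inj <-|mk]; first by rewrite -E ffunE eqxx.
  have := H k; rewrite mk /= ffunE ifN //.
  by apply/negP => /eqP E'; rewrite E' ltnn in mk.
move=> /forallP H; split.
  apply/forallP => k; apply/implyP => mk; have := H k; rewrite (ltnW mk) /= ffunE ifN //.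
  by apply/negP => /eqP E'; rewrite E' ltnn in mk.
rewrite ffunE eqxx eqxx andbT; apply/eqP/ffunP => k; rewrite !ffunE; case: eqP => // ->.
by have := H m; rewrite leqnn => /eqP.
Qed.

Let U' k := a k *: (U k + (0 < k)%N%:R *: (c k *: U (pred_ord k))).

(** Coordinates below [m] still carry their [V]-lines, the others their final lines; [stage s0 m]
    interpolates between the full sum at [m = N] and a single determinant at [m = 0]. *)
Let rows m (z : {ffun 'I_N -> J}) (k : 'I_N) := if (k < m)%N then V k (z k) else U' k.

Let stage s0 m := \sum_(z | supp s0 m z)
  (\prod_(k : 'I_N | (k < m)%N) w k (z (pred_ord k)) (z k)) * det_rows (rows m z).

Let prod_w_ok m (z : {ffun 'I_N -> J}) :
  \prod_(k : 'I_N | (k < m)%N) w k (z (pred_ord k)) (z k) != 0 ->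
  forall k : 'I_N, (k < m)%N -> ok k (z k).
Proof.
move=> nz k; move: {2}(k : nat) (leqnn k) => n; elim: n k => [|n IH] k kn km;
  apply: contraR nz => nok; apply/eqP; rewrite (bigD1 k) //= w_ok ?mul0r //.
- by rewrite ltnNge kn.
- move=> k0; apply: IH => /=; last exact: leq_ltn_trans (leq_pred k) km.
  by rewrite -ltnS prednK.
Qed.

Let stageS s0 (m : 'I_N) : stage s0 m.+1 = stage s0 m.
Proof.
rewrite /stage supp_split; apply: eq_bigr => z _.
have lt_neq (k : 'I_N) : (k < m)%N -> (k == m) = false.
  by move=> km; apply/negP => /eqP E; rewrite E ltnn in km.
pose t := z (pred_ord m).
(* For [m = 0] the predecessor of [m] is [m] itself, whose value [upd] overwrites; [w_first] makes
   the first weight blind to it. *)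
have pm s : w m (upd z m s (pred_ord m)) s = w m t s.
  case: (posnP m) => [m0|m0]; first exact: w_first.
  by rewrite /t ffunE lt_neq //= prednK.
have wprod s : \prod_(k : 'I_N | (k < m.+1)%N)
      w k (upd z m s (pred_ord k)) (upd z m s k) =
    (\prod_(k : 'I_N | (k < m)%N) w k (z (pred_ord k)) (z k)) * w m t s.
  rewrite (bigD1 m) //= mulrC; congr (_ * _); last by rewrite [X in w m _ X]ffunE eqxx pm.
  apply: eq_big => [k|k]; first by rewrite ltnS [RHS]ltn_neqAle andbC.
  move=> /andP[km km']; have {}km : (k < m)%N by rewrite ltn_neqAle -ltnS km andbT.
  by rewrite !ffunE !lt_neq //= (leq_ltn_trans (leq_pred k)).
have rowsE s : det_rows (rows m.+1 (upd z m s)) = det_rows (set_row (rows m z) m (V m s)).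
  apply: eq_det_rows => k; rewrite /rows /set_row ffunE ltnS leq_eqVlt val_eqE.
  by case: eqP => [->|].
under eq_bigr => s _ do rewrite wprod rowsE -mulrA.
rewrite -mulr_sumr -det_set_row_sum.
have [->|nz] := eqVneq (\prod_(k : 'I_N | (k < m)%N) w k (z (pred_ord k)) (z k)) 0.
  by rewrite !mul0r.
have tok : (0 < m)%N -> ok (pred_ord m) t.
  by move=> m0; apply: (prod_w_ok nz); rewrite /= prednK.
congr (_ * _); rewrite w_sum //.
have -> : a m *: (U m + (0 < m)%N%:R *:
    (c m *: U (pred_ord m) + c' m t *: V (pred_ord m) t)) =
    1 *: U' m + (a m * (0 < m)%N%:R * c' m t) *: V (pred_ord m) t.
  by rewrite /U' scale1r !scalerDr !scalerA addrA.
rewrite det_set_row_linear mul1r.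
have -> : det_rows (set_row (rows m z) m (U' m)) = det_rows (rows m z).
  by apply: eq_det_rows => k; rewrite /set_row /rows; case: eqP => // ->; rewrite ltnn.
case: (posnP m) => [m0|m0]; first by rewrite mulr0 !mul0r addr0.
have -> : V (pred_ord m) t = rows m z (pred_ord m) by rewrite /rows /= prednK // leqnn.
rewrite det_set_row_copy ?mulr0 ?addr0 //.
by apply/negP => /eqP/(congr1 val)/= E; have := prednK m0; rewrite E => /eqP;
  rewrite (gtn_eqF (ltnSn _)).
Qed.

(* [z] is summed out from the last coordinate to the first: the [V]-term created by
   coordinate [k] copies row [k - 1] of the current determinant and drops out at
   once; the [U]-terms are removed at the end by a unitriangular row operation. *)
Lemma det_rows_sweep (s0 : J) :
  \sum_(z : {ffun 'I_N -> J}) (\prod_k w k (z (pred_ord k)) (z k)) *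
     det_rows (fun k => V k (z k)) = \prod_k a k * det_rows U.
Proof.
have stageE m : (m <= N)%N -> stage s0 m = stage s0 0.
  by elim: m => // m IH mN; rewrite (stageS s0 (Ordinal mN)) IH // ltnW.
transitivity (stage s0 N).
  apply: eq_big => [z|z _].
    by apply/esym/idP; rewrite /supp; apply/forallP => k; rewrite leqNgt ltn_ord.
  congr (_ * _); first by apply: eq_bigl => k; rewrite ltn_ord.
  by apply: eq_det_rows => k; rewrite /rows ltn_ord.
rewrite stageE // /stage (big_pred1 [ffun=> s0]); last first.
  move=> z; apply/forallP/eqP => [H|-> k]; last by rewrite ffunE eqxx.
  by apply/ffunP => k; rewrite ffunE; have /eqP := H k.
rewrite [X in X * _]big_pred0 ?mul1r //.
rewrite -det_rows_add_pred /rows /=.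
have -> : det_rows U' = \det (diag_mx (\row_k a k) *m
     \matrix_k (U k + (0 < k)%N%:R *: (c k *: U (pred_ord k)))).
  congr (\det _); apply/row_matrixP => k.
  by rewrite row_mul row_diag_mx -scalemxAl -rowE !rowK !mxE.
by rewrite det_mulmx det_diag; congr (_ * _); apply: eq_bigr => k _; rewrite mxE.
Qed.

End Sweep.

(** * Generating functions and recursions of the determinant entries *)

Section SymmetricPolynomials.
Context (R : realType) (N : nat) (a : 'I_N -> R).
Implicit Types (S : {set 'I_N}).

(** Arbitrary index sets replace intervals so that variables can be added one at a time, at either
    end of an interval. *)
Definition esum_set S (r : nat) : R :=
  \sum_(A : {set 'I_N} | (A \subset S) && (#|A| == r)) \prod_(k in A) a k.

Definition hsum_set S (r : nat) : R :=
  \sum_(m : {ffun 'I_N -> 'I_r.+1} |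
          [forall k, (k \notin S) ==> (m k == 0%N :> nat)]
          && (\sum_(k < N) m k == r)%N)
    \prod_(k < N) a k ^+ m k.

Lemma coef_prod_monomial (A : pred 'I_N) (e : 'I_N -> nat) r :
  (\prod_(k | A k) (a k ^+ e k *: 'X^(e k)))`_r =
  if (\sum_(k | A k) e k == r)%N then \prod_(k | A k) a k ^+ e k else 0.
Proof.
rewrite scaler_prod prodrXr coefZ coefXn eq_sym.
by case: eqP; rewrite ?mulr1 ?mulr0.
Qed.

Lemma esum_setE S r :
  esum_set S r = (\prod_(k in S) (a k *: 'X + 1))`_r.
Proof.
have -> : \prod_(k in S) (a k *: 'X + 1) =
    \prod_k ((if k \in S then a k *: 'X else 0) + 1) :> {poly R}.
  by rewrite big_mkcond; apply: eq_bigr => k _; case: ifP => // _; rewrite add0r.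
rewrite bigA_distr coef_sum /esum_set big_mkcondr /= big_mkcond /=.
apply: eq_big => // J _; case: ifPn => [JS|/subsetPn[k kJ kS]]; last first.
  by rewrite (bigD1 k) //= kJ (negPf kS) mul0r coef0.
rewrite -big_mkcond /= (eq_bigr (fun k => a k ^+ 1 *: 'X^1)); last first.
  by move=> k kJ; rewrite (fintype.subsetP JS) // expr1.
by rewrite coef_prod_monomial sum1_card.
Qed.

Definition geom_poly r (x : 'I_N) : {poly R} := \poly_(m < r.+1) (a x ^+ m).

Lemma coef_geom_poly r x m : (m <= r)%N -> (geom_poly r x)`_m = a x ^+ m.
Proof.
by move=> mr; rewrite coef_poly ltnS mr.
Qed.

(** The generating function is a product of geometric series, and truncating each at a degree
    [D >= r] leaves the coefficient of degree [r] unchanged. The freedom in [D] lets coefficients of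
    two degrees be read off one product. *)
Lemma hsum_setE S r D : (r <= D)%N -> hsum_set S r = (\prod_(k in S) geom_poly D k)`_r.
Proof.
move=> rD; transitivity (\prod_(k in S) geom_poly r k)`_r; last first.
  suff : forall m, (m <= r)%N ->
    (\prod_(k in S) geom_poly r k)`_m = (\prod_(k in S) geom_poly D k)`_m by apply.
  apply: (big_ind2 (fun p q : {poly R} => forall m, (m <= r)%N -> p`_m = q`_m)) => //.
    move=> p1 p2 q1 q2 E1 E2 m mr; rewrite !coefM; apply: eq_bigr => i _.
    by rewrite E1 ?E2 // (leq_trans _ mr) ?leq_subr // -ltnS.
  by move=> k _ m mr; rewrite !coef_geom_poly // (leq_trans mr).
have -> : \prod_(k in S) geom_poly r k =
    \prod_(k < N) \sum_(m < r.+1 | (k \notin S) ==> (m == 0%N :> nat)) (a k ^+ m *: 'X^m).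
  rewrite big_mkcond; apply: eq_bigr => k _ /=; case: ifP => kS /=.
    by rewrite /geom_poly poly_def.
  rewrite (big_pred1 ord0) ?expr0 ?scale1r // => m /=.
rewrite bigA_distr_big_dep coef_sum /hsum_set big_mkcondr /=.
apply: eq_big => [f|f _].
  by rewrite unfold_in.
by rewrite coef_prod_monomial.
Qed.

Lemma esum_set0 r : esum_set finset.set0 r = (r == 0%N)%:R.
Proof. by rewrite esum_setE finset.big_set0 coef1. Qed.

Lemma hsum_set0 r : hsum_set finset.set0 r = (r == 0%N)%:R.
Proof. by rewrite (hsum_setE _ (leqnn r)) finset.big_set0 coef1. Qed.

Lemma esum_setU1_0 (x : 'I_N) S : x \notin S -> esum_set (x |: S) 0 = esum_set S 0.
Proof.
move=> xS; rewrite !esum_setE big_setU1 //= mulrDl mul1r.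
by rewrite -scalerAl coefD coefZ coefXM mulr0 add0r.
Qed.

Lemma esum_setU1S (x : 'I_N) S r : x \notin S ->
  esum_set (x |: S) r.+1 = esum_set S r.+1 + a x * esum_set S r.
Proof.
by move=> xS; rewrite !esum_setE big_setU1 //= mulrDl mul1r -scalerAl coefD coefZ coefXM addrC.
Qed.

Lemma hsum_setU1_0 (x : 'I_N) S : x \notin S -> hsum_set (x |: S) 0 = hsum_set S 0.
Proof.
move=> xS; rewrite !(hsum_setE _ (leqnn 0)) big_setU1 //= coefM big_ord1.
by rewrite coef_geom_poly // expr0 mul1r.
Qed.

Lemma hsum_setU1S (x : 'I_N) S r : x \notin S ->
  hsum_set (x |: S) r.+1 = hsum_set S r.+1 + a x * hsum_set (x |: S) r.
Proof.
move=> xS; rewrite !(hsum_setE _ (leqnn r.+1)) (hsum_setE _ (leqnSn r)) big_setU1 //=.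
rewrite !coefM big_ord_recl /= coef_geom_poly // expr0 mul1r subn0; congr (_ + _).
rewrite mulr_sumr; apply: eq_bigr => i _.
rewrite !coef_geom_poly ?ltnS ?(leq_trans (leq_ord i)) // exprS mulrA.
by rewrite /bump leq0n add1n subSS.
Qed.

Lemma esum_set_gt S r : (#|S| < r)%N -> esum_set S r = 0.
Proof.
move=> Sr; rewrite /esum_set big_pred0 // => A; apply/negP => /andP[/subset_leq_card AS /eqP E].
by move: Sr; rewrite -E ltnNge AS.
Qed.

Definition ord_itv (i j : 'I_N) : {set 'I_N} :=
  [set k : 'I_N | (i < k <= j)%N]%SET.

Lemma ord_itvxx i : ord_itv i i = finset.set0.
Proof. by apply/setP => k; rewrite !inE; apply/negP; lia. Qed.

Lemma ord_itv_rcons (i j : 'I_N) : (i < j)%N -> ord_itv i j = j |: ord_itv i (pred_ord j).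
Proof. by move=> ij; apply/setP => k; rewrite !inE -val_eqE /=; lia. Qed.

Lemma ord_itv_cons (i j : 'I_N) : (0 < i)%N -> (i <= j)%N ->
  ord_itv (pred_ord i) j = i |: ord_itv i j.
Proof. by move=> i0 ij; apply/setP => k; rewrite !inE -val_eqE /=; lia. Qed.

Lemma esymE (i j : 'I_N) r : Defs.esym i j a r = esum_set (ord_itv i j) r.
Proof. by []. Qed.

Lemma hsymE (i j : 'I_N) r : hsym i j a r = hsum_set (ord_itv i j) r.
Proof.
by apply: eq_bigl => m; congr (_ && _); apply: eq_forallb => k; rewrite inE.
Qed.

Lemma card_ord_itv (i j : 'I_N) : (#|ord_itv i j| <= j - i)%N.
Proof.
move: {2}(j : nat) (leqnn j) => d; elim: d j => [|d IH] j jd.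
  rewrite (_ : ord_itv i j = finset.set0) ?cards0 //.
  by apply/setP => k; rewrite !inE; apply/negP; lia.
have [ij|ji] := ltnP i j.
  rewrite ord_itv_rcons // cardsU1; apply: leq_trans (leq_add (leq_b1 _) (IH _ _)) _ => /=; lia.
rewrite (_ : ord_itv i j = finset.set0) ?cards0 //.
by apply/setP => k; rewrite !inE; apply/negP; lia.
Qed.

(* The coefficient of [u^-l] in [phi_i(u) / phi_j(u)]. *)
Definition transf_coef (i j : 'I_N) (l : nat) : R :=
  if (j <= i)%N then (-1) ^+ l * Defs.esym j i a l else hsym i j a l.

(** Multiplication by 1/u on coefficient sequences; a factor 1 - a/u becomes a two-term
    recursion. *)
Definition lag (u : nat -> R) (l : nat) : R := if l is m.+1 then u m else 0.

Lemma transf_coefxx i l : transf_coef i i l = (l == 0%N)%:R.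
Proof.
rewrite /transf_coef leqnn esymE ord_itvxx esum_set0.
by case: l => [|l] /=; rewrite ?expr0 ?mulr1 ?mulr0.
Qed.

Lemma transf_coef_le (i j : 'I_N) l : (i <= j)%N -> transf_coef i j l = hsym i j a l.
Proof.
rewrite leq_eqVlt => /orP[/eqP/val_inj <-|ij]; last by rewrite /transf_coef leqNgt ij.
by rewrite transf_coefxx hsymE ord_itvxx hsum_set0.
Qed.

Lemma transf_coef_gt (i j : 'I_N) l : (j <= i)%N -> (i - j < l)%N -> transf_coef i j l = 0.
Proof.
move=> ji il; rewrite /transf_coef ji esymE esum_set_gt ?mulr0 //.
exact: leq_ltn_trans (card_ord_itv _ _) il.
Qed.

Let ge_coef (i j : 'I_N) l : (j <= i)%N ->
  transf_coef i j l = (-1) ^+ l * esum_set (ord_itv j i) l.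
Proof. by rewrite /transf_coef => ->. Qed.

(** For [i <= j] the factor 1 - a_i/u cancels a factor of the complete homogeneous generating
    function, for [j < i] it adds one to the elementary generating function. The diagonal is reached
    here from the homogeneous side, in [transf_coef_col] from the elementary side. *)
Lemma transf_coef_row (i j : 'I_N) l : (0 < i)%N ->
  transf_coef i j l = transf_coef (pred_ord i) j l - a i * lag (transf_coef (pred_ord i) j) l.
Proof.
move=> i0; have [ij|ji] := leqP i j.
  have ij' : (pred_ord i <= j)%N by rewrite /=; lia.
  have iN : i \notin ord_itv i j by rewrite inE; lia.
  rewrite !transf_coef_le // !hsymE ord_itv_cons //.
  case: l => [|l] /=; first by rewrite hsum_setU1_0 // mulr0 subr0.
  by rewrite transf_coef_le // hsymE ord_itv_cons // hsum_setU1S // addrK.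
have ji' : (j <= pred_ord i)%N by rewrite /=; lia.
have iN : i \notin ord_itv j (pred_ord i) by rewrite inE /=; lia.
rewrite !ge_coef ?(ltnW ji) // ord_itv_rcons //.
case: l => [|l] /=; first by rewrite esum_setU1_0 // mulr0 subr0.
by rewrite ge_coef // esum_setU1S // exprS; ring.
Qed.

Lemma transf_coef_col (i j : 'I_N) l : (0 < j)%N ->
  transf_coef i (pred_ord j) l = transf_coef i j l - a j * lag (transf_coef i j) l.
Proof.
move=> j0; have [ij|ji] := ltnP i j.
  have ij' : (i <= pred_ord j)%N by rewrite /=; lia.
  have jN : j \notin ord_itv i (pred_ord j) by rewrite inE /=; lia.
  rewrite !transf_coef_le ?(ltnW ij) // !hsymE (ord_itv_rcons ij).
  case: l => [|l] /=; first by rewrite hsum_setU1_0 // mulr0 subr0.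
  by rewrite transf_coef_le ?(ltnW ij) // hsymE (ord_itv_rcons ij) hsum_setU1S // addrK.
have ji' : (pred_ord j <= i)%N by rewrite /=; lia.
have jN : j \notin ord_itv j i by rewrite inE /=; lia.
rewrite !ge_coef // ord_itv_cons //.
case: l => [|l] /=; first by rewrite esum_setU1_0 // mulr0 subr0.
by rewrite ge_coef // esum_setU1S // exprS; ring.
Qed.

Lemma cvg_series_finite (u : nat -> R) n : (forall l, (n <= l)%N -> u l = 0) ->
  series u @ \oo --> \sum_(0 <= l < n) u l.
Proof.
move=> u0; apply: cvg_near_cst; exists n => // m /= nm.
rewrite /series /= (big_cat_nat (n := n)) //= [X in _ + X]big_nat_cond.
rewrite [X in _ + X]big1 ?addr0 //.
by move=> l /andP[/andP[nl _] _]; apply: u0.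
Qed.

(** The coefficients vanish beyond [i - j] when [j <= i], so the finite branch is also a limit of
    partial sums and both branches can be treated alike. *)
Lemma transf_series (f : int -> R) i j x :
  transf f a i j x = limn (series (fun l => transf_coef i j l * f (x + l%:Z))).
Proof.
rewrite /transf; case: ifPn => ji; last first.
  congr (limn (series _)); apply/funext => l.
  by rewrite /transf_coef (negPf ji).
apply/esym/cvg_lim => //.
rewrite (eq_bigr (fun l => transf_coef i j l * f (x + l%:Z))); last first.
  by move=> l _; rewrite /transf_coef ji.
by apply: cvg_series_finite => l il; rewrite transf_coef_gt ?mul0r.
Qed.

(** Reflection carries the pushing entries to the blocking type. A function supported on nonnegative
    integers becomes one vanishing on positive integers, whose series have finitely many nonzero
    terms. *)
Lemma transhat_transf (f : int -> R) i j x :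
  transhat f a i j x = transf (fun y => f (- y)) a i j (- x).
Proof.
rewrite /transhat /transf; case: ifP => _.
  by apply: eq_bigr => l _ /=; rewrite opprD opprK.
by congr (limn (series _)); apply/funext => l /=; rewrite opprD opprK.
Qed.

Lemma lag_series (c d : nat -> R) (f : int -> R) (al : R) x :
  (forall l, c l = d l - al * lag d l) ->
  (forall x, cvgn (series (fun l => d l * f (x + l%:Z)))) ->
  limn (series (fun l => c l * f (x + l%:Z))) =
  limn (series (fun l => d l * f (x + l%:Z))) -
  al * limn (series (fun l => d l * f (x + 1 + l%:Z))).
Proof.
move=> cE fd; apply/cvg_lim => //.
have -> : series (fun l => c l * f (x + l%:Z)) =
  series (fun l => d l * f (x + l%:Z)) - al *: series (fun l => lag d l * f (x + l%:Z)).
  apply/funext => n; rewrite /series /= !fctE scaler_sumr -sumrB.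
  by apply: eq_bigr => l _; rewrite cE /GRing.scale /=; ring.
apply: cvgB; first exact: fd.
apply: cvgZl_tmp.
(* Dropping the first term, which is zero, turns the lag into a shift of the argument: index l + 1
   at x is index l at x + 1. *)
rewrite -cvg_shiftS.
have -> : [sequence (series (fun l => lag d l * f (x + l%:Z))) n.+1]_n =
   series (fun l => d l * f (x + 1 + l%:Z)).
  apply/funext => n; rewrite /series /= big_nat_recl // mul0r add0r.
  by apply: eq_bigr => l _; congr (_ * f _); lia.
exact: fd.
Qed.

Definition summable_with (f : int -> R) :=
  forall i j x, cvgn (series (fun l => transf_coef i j l * f (x + l%:Z))).

Lemma transf_row (f : int -> R) (i j : 'I_N) x : summable_with f -> (0 < i)%N ->
  transf f a i j x =
  transf f a (pred_ord i) j x - a i * transf f a (pred_ord i) j (x + 1).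
Proof.
by move=> sf i0; rewrite !transf_series; apply: lag_series => // l; apply: transf_coef_row.
Qed.

Lemma transf_col (f : int -> R) (i j : 'I_N) x : summable_with f -> (0 < j)%N ->
  transf f a i (pred_ord j) x = transf f a i j x - a j * transf f a i j (x + 1).
Proof.
by move=> sf i0; rewrite !transf_series; apply: lag_series => // l; apply: transf_coef_col.
Qed.

Lemma transf_rec (f g : int -> R) s (c : int) i j x :
  (forall y, g y = f y + s * f (y + c)) -> summable_with f ->
  transf g a i j x = transf f a i j x + s * transf f a i j (x + c).
Proof.
move=> gE sf; rewrite !transf_series; apply/cvg_lim => //.
have -> : series (fun l => transf_coef i j l * g (x + l%:Z)) =
  series (fun l => transf_coef i j l * f (x + l%:Z)) +
  s *: series (fun l => transf_coef i j l * f (x + c + l%:Z)).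
  apply/funext => n; rewrite /series /= !fctE scaler_sumr -big_split.
  apply: eq_bigr => l _; rewrite gE addrAC.
  by rewrite /GRing.scale /=; ring.
by apply: cvgD; [|apply: cvgZl_tmp]; exact: sf.
Qed.

Lemma transfxx (f : int -> R) i x : transf f a i i x = f x.
Proof.
rewrite transf_series; apply/cvg_lim => //.
have := @cvg_series_finite (fun l => transf_coef i i l * f (x + l%:Z)) 1.
rewrite big_nat1 transf_coefxx mul1r addr0; apply => l l0.
by rewrite transf_coefxx gtn_eqF // mul0r.
Qed.

Lemma transf_eq0 (f : int -> R) (i j : 'I_N) x :
  (forall l, transf_coef i j l * f (x + l%:Z) = 0) -> transf f a i j x = 0.
Proof.
move=> H; rewrite transf_series; apply/cvg_lim => //.
by have := @cvg_series_finite _ 0 (fun l _ => H l); rewrite big_geq.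
Qed.

Lemma transf_low (f : int -> R) (i j : 'I_N) x :
  (forall y, y < 0 -> f y = 0) -> (j <= i)%N -> x + i%:Z < j%:Z -> transf f a i j x = 0.
Proof.
move=> f0 ji xij; apply: transf_eq0 => l.
have [il|li] := ltnP (i - j) l; first by rewrite transf_coef_gt ?mul0r.
by rewrite f0 ?mulr0 //; lia.
Qed.

Lemma transf_high (f : int -> R) (i j : 'I_N) x :
  (forall y, 0 < y -> f y = 0) -> 0 < x -> transf f a i j x = 0.
Proof.
by move=> f0 x0; apply: transf_eq0 => l; rewrite f0 ?mulr0 //; lia.
Qed.

Lemma summable_with_bounded (f : int -> R) (B : int) :
  (forall y, B < y -> f y = 0) -> summable_with f.
Proof.
move=> f0 i j x; apply: cvgP.
apply: (@cvg_series_finite _ (absz (B - x)).+1) => l Bl.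
by rewrite f0 ?mulr0 //; lia.
Qed.

End SymmetricPolynomials.

(** * The functions [wfun] and [vfun], and convergence of the entry series *)

Section Negative_binomial.
Context (R : realType).

Lemma wfun_rec n (x : int) : wfun R n x = wfun R n.+1 x - wfun R n.+1 (x - 1).
Proof.
case: x => [[|m]|m]; first by rewrite /= !bin0 subr0.
  rewrite (_ : m.+1%:Z - 1 = m%:Z); last by lia.
  by rewrite /= !addnS /= binS natrD addrK.
by rewrite /= subr0.
Qed.

Lemma vfun_rec n (x : int) : vfun R n.+1 x = vfun R n x + vfun R n (x - 1).
Proof.
case: x => [[|m]|m]; first by rewrite /= !bin0 addr0.
  rewrite (_ : m.+1%:Z - 1 = m%:Z); last by lia.
  by rewrite /= binS natrD.
by rewrite /= addr0.
Qed.

Lemma wfun_lt0 n (x : int) : x < 0 -> wfun R n x = 0.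
Proof. by case: x. Qed.

Lemma vfun_lt0 n (x : int) : x < 0 -> vfun R n x = 0.
Proof. by case: x. Qed.

Lemma vfun_gt n (x : int) : n%:Z < x -> vfun R n x = 0.
Proof. by case: x => // m nm; rewrite /= bin_small. Qed.

Lemma wfun0 (x : int) : wfun R 0 x = (x == 0)%:R.
Proof. by case: x => [[|m]|m] //=; rewrite bin_small. Qed.

Lemma vfun0 (x : int) : vfun R 0 x = (x == 0)%:R.
Proof. by case: x => [[|m]|m]. Qed.

Lemma wfun_ge0 n x : 0 <= wfun R n x.
Proof. by case: x => m //=. Qed.

(** The constant is the generating function (1 - x)^-n at x = 1/s, which dominates each of its
    terms. In the double induction the two bounds add up exactly to the next one. *)
Lemma wfun_bound n (s : R) (m : nat) : 1 < s -> wfun R n m%:Z <= (s / (s - 1)) ^+ n * s ^+ m.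
Proof.
move=> s1; have s0 : 0 < s - 1 by rewrite subr_gt0.
have K0 : 0 <= s / (s - 1) by rewrite divr_ge0 ?ltW // (lt_trans _ s1).
elim: n m => [|n IH] m.
  by rewrite wfun0 expr0 mul1r; case: eqP => _ /=; rewrite ?exprn_ege1 ?exprn_ge0 //; lra.
elim: m => [|m IHm].
  rewrite /= bin0 expr0 mulr1 exprn_ege1 // ler_pdivlMr // mul1r; lra.
have -> : wfun R n.+1 m.+1%:Z = wfun R n m.+1%:Z + wfun R n.+1 m%:Z.
  by rewrite (wfun_rec n) (_ : m.+1%:Z - 1 = m%:Z) ?subrK //; lia.
apply: le_trans (lerD (IH _) IHm) _.
rewrite le_eqVlt; apply/orP; left; apply/eqP.
by rewrite !exprS; field; lra.
Qed.

(** Each added variable multiplies the constant by r / (r - a_x), so the constant produced is the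
    generating function at 1/r. *)
Lemma hsum_set_bound N (a : 'I_N -> R) (r : R) (S : {set 'I_N}) :
  0 < r -> (forall k, 0 < a k < r) ->
  exists2 C, 0 <= C & forall l, hsum_set a S l <= C * r ^+ l.
Proof.
move=> r0 ar; move: {2}(#|S|) (leqnn #|S|) => n; elim: n S => [|n IH] S Sn.
  have -> : S = finset.set0 by apply/eqP; rewrite -cards_eq0 -leqn0.
  exists 1 => // -[|l]; rewrite hsum_set0 ?expr0 ?mulr1 //= mul1r exprn_ge0 //.
  exact: ltW.
have [->|[x xS]] := set_0Vmem S; first by apply: IH; rewrite cards0.
have /andP[ax0 axr] := ar x.
have [|C C0 HC] := IH (S :\ x)%SET; first by have := cardsD1 x S; rewrite xS; lia.
have rx : 0 < r - a x by rewrite subr_gt0.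
exists (C * (r / (r - a x))); first by rewrite mulr_ge0 // divr_ge0 // ltW.
have C1 : C <= C * (r / (r - a x)).
  by rewrite ler_peMr // ler_pdivlMr // mul1r gerBl ltW.
rewrite -(finset.setD1K xS); have xS' : x \notin (S :\ x)%SET by rewrite !inE eqxx.
elim=> [|l IHl].
  by rewrite hsum_setU1_0 //; apply: le_trans (HC 0%N) _; rewrite !expr0 !mulr1.
rewrite hsum_setU1S //.
apply: le_trans (lerD (HC _) (ler_wpM2l (ltW ax0) IHl)) _.
rewrite le_eqVlt; apply/orP; left; apply/eqP.
by rewrite exprS; field; lra.
Qed.
Lemma hsum_set_ge0 N (a : 'I_N -> R) (S : {set 'I_N}) l :
  (forall k, 0 <= a k) -> 0 <= hsum_set a S l.
Proof.
by move=> a0; apply: sumr_ge0 => m _; apply: prodr_ge0 => k _; apply: exprn_ge0.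
Qed.

(** The sum is infinite only for [i < j]. There h_l is at most of order r^l with r between the
    largest a_k and 1, and w_n(m) at most of order s^m with s between 1 and 1/r; a geometric series
    of ratio r s < 1 dominates. Both rates are midpoints. *)
Lemma summable_with_wfun N (a : 'I_N -> R) n : (forall k, 0 < a k < 1) ->
  summable_with a (wfun R n).
Proof.
move=> a01 i j x; have [ji|ij] := leqP j i.
  apply: cvgP; apply: (@cvg_series_finite _ _ (i - j).+1) => l il.
  by rewrite transf_coef_gt ?mul0r.
pose M := \big[Num.max/0]_k a k.
have M1 : M < 1 by apply/bigmax_ltP; split=> // k _; case/andP: (a01 k).
have M0 : 0 <= M by apply: bigmax_ge_id.
pose r := (1 + M) / 2.
have [r0 r1] : 0 < r /\ r < 1 by rewrite /r; split; lra.
have ar k : 0 < a k < r.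
  case/andP: (a01 k) => -> _ /=; have : a k <= M by apply: le_bigmax.
  by rewrite /r; lra.
have [C C0 HC] := hsum_set_bound (ord_itv i j) r0 ar.
pose s := (1 + r^-1) / 2.
have ri1 : 1 < r^-1 by rewrite invf_gt1.
have s1 : 1 < s by rewrite /s; lra.
have s0 : 0 < s by lra.
have sr : r * s < 1.
  by rewrite /s mulrA mulrDr mulfV ?gt_eqF // mulr1; lra.
pose K := (s / (s - 1)) ^+ n.
have K0 : 0 <= K by rewrite exprn_ge0 // divr_ge0 //; lra.
have Kb m : wfun R n m%:Z <= K * s ^+ m by apply: wfun_bound.
clearbody K s r.
apply: (@series_le_cvg _ _ (geometric (C * K * s ^+ (absz x)) (r * s))).
- move=> l; rewrite mulr_ge0 ?wfun_ge0 // transf_coef_le 1?ltnW // hsymE hsum_set_ge0 //.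
  by move=> k; case/andP: (a01 k) => /ltW.
- by move=> l; rewrite /geometric /=; do ![apply: mulr_ge0|apply: exprn_ge0] => //; apply: ltW.
- move=> l; rewrite transf_coef_le 1?ltnW // hsymE /geometric /=.
  rewrite exprMn [leRHS](_ : _ = (C * r ^+ l) * (K * s ^+ (absz x + l))); last first.
    by rewrite exprD; ring.
  apply: ler_pM; rewrite ?wfun_ge0 ?hsum_set_ge0 //.
    by move=> k; case/andP: (a01 k) => /ltW.
  case E : (x + l%:Z) => [m|m]; last first.
    by rewrite /= mulr_ge0 ?exprn_ge0 //; lra.
  apply: le_trans (Kb _) _; rewrite ler_wpM2l // ler_weXn2l ?(ltW s1) //; lia.
apply: is_cvg_geometric_series; rewrite ger0_norm // mulr_ge0 //; lra.
Qed.

End Negative_binomial.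

(** * Finite additivity and independence with real-valued probabilities *)

Section FiniteFamilies.
Context d (T : measurableType d) (R : realType) (P : probability T R).

Lemma uniq_fset (K : choiceType) (s : seq K) : uniq s ->
  exists X : {fset K}, perm_eq X s.
Proof. by move=> us; exists (seq_fset tt s); rewrite -{2}(undup_id us) seq_fset_perm. Qed.

Lemma fine_measure_disjoint (J : finType) (F : J -> set T) :
  (forall c, measurable (F c)) -> (forall c c' t, F c t -> F c' t -> c = c') ->
  measurable (\bigcup_c F c) /\ fine (P (\bigcup_c F c)) = \sum_c fine (P (F c)).
Proof.
move=> mF disj; have mU : measurable (\bigcup_c F c).
  by apply: fin_bigcup_measurable => // ; exact: finite_finset.
split=> //.
have [X pX] := uniq_fset (index_enum_uniq J).
have -> : \bigcup_c F c = \big[setU/set0]_(c <- X) F c.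
  rewrite (perm_big _ pX) /=.
  by rewrite -bigcup_seq; apply: eq_bigcupl; split=> c //= _; rewrite mem_index_enum.
rewrite measure_fbigsetU //; last first.
  by apply/trivIsetP => c c' _ _ cc'; apply/seteqP; split=> t // -[/disj H /H E];
    rewrite E eqxx in cc'.
rewrite (perm_big _ pX) /=.
by rewrite -sum_fine // => c _; rewrite fin_num_measure.
Qed.

Lemma fine_independent (I : choiceType) (D : set I) (F : I -> set (set T)) (s : seq I)
    (A : I -> set T) :
  mutually_independent P D F -> uniq s ->
  (forall i, i \in s -> D i) -> (forall i, i \in s -> F i (A i)) ->
  (forall i, i \in s -> measurable (A i)) ->
  fine (P [set t | forall i, i \in s -> A i t]) = \prod_(i <- s) fine (P (A i)).
Proof.
move=> indep us sD sF sA.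
have [X pX] := uniq_fset us; have memX := perm_mem pX.
have -> : [set t | forall i, i \in s -> A i t] = \bigcap_(i in [set` X]) A i.
  by apply/seteqP; split=> t /= H i; [rewrite /= memX | rewrite -memX]; apply: H.
rewrite indep; last first.
- by move=> i; rewrite memX => /sF.
- by move=> i /=; rewrite memX => /sD.
rewrite (perm_big _ pX) /=.
rewrite big_seq (eq_bigr (fun i => (fine (P (A i)))%:E)); last first.
  by move=> i si; rewrite fineK // fin_num_measure //; exact: sA.
by rewrite prodEFin /= -big_seq.
Qed.

End FiniteFamilies.

(** * From the probability space to powers of a finite matrix *)

Section ChainKernel.
Context d (T : measurableType d) (R : realType) (P : probability T R) (N : nat).
Variables (S : pred (state N)) (step : step_type N).
(** [loc k r x z] is what a step from [x] to [z] demands of the noise value [r] of coordinate [k]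
    alone; independence then turns one-step probabilities into products of [wt k x z]. *)
Variable loc : 'I_N -> nat -> state N -> state N -> bool.
Variable wt : 'I_N -> state N -> state N -> R.
Variables (xi : 'I_N -> nat -> {RV P >-> nat}) (Y : nat -> T -> state N).

Hypothesis stepE : forall u x z, step u x z <-> forall k, loc k (u k) x z.
Hypothesis stepS : forall u x z, S x -> step u x z -> S z.
Hypothesis step_fun : forall u x z z', step u x z -> step u x z' -> z = z'.
Hypothesis wtE : forall k m x z, (1 <= m)%N -> S x -> S z ->
  P (xi k m @^-1` [set r | loc k r x z]) = (wt k x z)%:E.
Hypothesis chain : is_chain S step xi Y.

Lemma chain_S n t : S (Y n t).
Proof.
case: chain => Y0 _ _ Yst; elim: n => [|n IH]; first exact: Y0.
exact: stepS IH (Yst n t).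
Qed.

Definition step_weight x z : R := if S x && S z then \prod_k wt k x z else 0.

Variables (J : finType) (emb : J -> state N).
Hypothesis emb_inj : injective emb.

Fixpoint step_weights n (b c : J) : R :=
  if n is m.+1 then \sum_e step_weights m b e * step_weight (emb e) (emb c) else (b == c)%:R.

(** The recursive definition splits off the last step; the backward equation needs the first. *)
Lemma step_weightsSl n b c :
  step_weights n.+1 b c = \sum_e step_weight (emb b) (emb e) * step_weights n e c.
Proof.
elim: n c => [|n IH] c.
  rewrite /= (bigD1 b) //= eqxx mul1r big1 ?addr0; last first.
    by move=> e eb; rewrite eq_sym (negPf eb) mul0r.
  rewrite (bigD1 c) //= eqxx mulr1 big1 ?addr0 // => e ec.
  by rewrite (negPf ec) mulr0.
transitivity (\sum_e step_weights n.+1 b e * step_weight (emb e) (emb c)) => //.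
under eq_bigr => e _ do rewrite IH mulr_suml.
rewrite exchange_big /=; apply: eq_bigr => e _.
by rewrite mulr_sumr; apply: eq_bigr => f _; rewrite mulrA.
Qed.

Variable b0 : J.
Hypothesis box : forall n t, Y 0%N t = emb b0 ->
  (exists b, Y n.+1 t = emb b) -> exists b, Y n t = emb b.

Let cylinder n b (s : seq ('I_N * nat)) (B : 'I_N * nat -> set nat) : set T :=
  [set t | [/\ Y 0%N t = emb b0, Y n t = emb b &
    forall km, km \in s -> B km (xi km.1 km.2 t)]].

Let pre B (km : 'I_N * nat) : set T := xi km.1 km.2 @^-1` B.

Let mpre B km : measurable (pre B km).
Proof. exact: measurable_funPTI. Qed.

(** Constraints on later noise are carried along so that the induction closes: the last step is
    itself a constraint on the noise of time n + 1 and joins the list. At time 0 only [Y 0] and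
    noise variables remain, which are independent by assumption. *)
Let cylinder_prob n b s (B : 'I_N * nat -> set nat) : uniq s ->
  (forall km, km \in s -> (n < km.2)%N) ->
  measurable (cylinder n b s B) /\
  fine (P (cylinder n b s B)) =
  fine (P [set t | Y 0%N t = emb b0]) * step_weights n b0 b *
  \prod_(km <- s) fine (P (pre (B km) km)).
Proof.
case: chain => Y0 mY0 indep Yst.
have mY0e : measurable [set t | Y 0%N t = emb b0].
  by apply: mY0; exists [set emb b0] => //; rewrite setTI.
elim: n b s B => [|n IH] b s B us sn.
  have [->|bb0] := eqVneq b b0; last first.
    have -> : cylinder 0 b s B = set0.
      by apply/seteqP; split=> t // -[-> /emb_inj E]; rewrite E eqxx in bb0.
    by rewrite measure0 /= eq_sym (negPf bb0) mulr0 mul0r.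
  pose A (i : option ('I_N * nat)) := if i is Some km then pre (B km) km
    else [set t | Y 0%N t = emb b0].
  have mA i : measurable (A i) by case: i => [km|] //=; exact: mpre.
  have cylE : cylinder 0 b0 s B = [set t | forall i, i \in None :: map Some s -> A i t].
    apply/seteqP; split=> t.
      case=> Y0t _ H [km|] //; rewrite in_cons /= mem_map; last exact: Some_inj.
      exact: H.
    move=> /= H; have Y0t := H None (mem_head _ _); split=> // km ks.
    by apply: (H (Some km)); rewrite in_cons /= mem_map //; exact: Some_inj.
  have uS : uniq (None :: map Some s).
    rewrite /= map_inj_uniq ?us ?andbT; last exact: Some_inj.
    by apply/mapP => -[].
  split.
    rewrite cylE.
    have -> : [set t | forall i, i \in None :: map Some s -> A i t] =
      \bigcap_(i in [set` None :: map Some s]) A i by [].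
    by apply: fin_bigcap_measurable => //; exact: finite_seq.
  rewrite cylE (fine_independent indep uS) //.
  - by rewrite big_cons big_map /= eqxx mulr1.
  - move=> [[k m]|] //=; rewrite in_cons /= mem_map; last exact: Some_inj.
    by move=> /sn.
  - move=> [[k m]|] //= _; first by exists (B (k, m)) => //; rewrite setTI.
    by exists [set emb b0] => //; rewrite setTI.
pose s' := [seq (k, n.+1) | k <- enum 'I_N] ++ s.
pose B' c (km : 'I_N * nat) : set nat :=
  if km.2 == n.+1 then [set r | loc km.1 r (emb c) (emb b)] else B km.
(* The sets are emptied outside [S], where [wt] need not be the probability; nothing is lost because
   the chain stays in [S]. By [box], these sets over all [c] exhaust the event. *)
pose F c := if S (emb c) && S (emb b) then cylinder n c s' (B' c) else set0.
have us' : uniq s'.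
  rewrite cat_uniq us andbT map_inj_uniq ?enum_uniq /=; last by move=> ? ? [].
  apply/hasPn => -[k m] /sn /= nm; apply/mapP => -[k' _ [_ E]].
  by rewrite E ltnn in nm.
have sn' km : km \in s' -> (n < km.2)%N.
  rewrite mem_cat => /orP[/mapP[k _ ->]//|/sn]; exact: ltnW.
have FP c : measurable (F c) /\ fine (P (F c)) =
    fine (P [set t | Y 0%N t = emb b0]) *
    (step_weights n b0 c * step_weight (emb c) (emb b)) *
    \prod_(km <- s) fine (P (pre (B km) km)).
  rewrite /F /step_weight; case: ifPn => [/andP[Sc Sb]|_]; last first.
    by rewrite measure0 mulr0 mulr0 mul0r.
  have [mC ->] := IH c _ (B' c) us' sn'; split=> //.
  rewrite big_cat /= big_map big_enum /= !mulrA; congr (_ * _ * _).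
    by apply: eq_bigr => k _; rewrite /pre /B' /= eqxx wtE.
  rewrite !big_seq; apply: eq_bigr => km /sn nkm.
  by rewrite /B' gtn_eqF.
have cylE : cylinder n.+1 b s B = \bigcup_c F c.
  apply/seteqP; split=> t.
    case=> Y0t Yt Bt; have [c Yc] : exists c, Y n t = emb c by apply: box => //; exists b.
    exists c => //; rewrite /F -Yc -Yt !chain_S /=; split=> // km.
    rewrite mem_cat /B' => /orP[/mapP[k _ ->]|ks] /=.
      by rewrite eqxx -Yc -Yt; have /stepE := Yst n t; apply.
    by rewrite gtn_eqF ?sn //; apply: Bt.
  case=> c _; rewrite /F; case: ifP => // /andP[Sc Sb] [Y0t Yc Bt]; split=> //.
    have st : step (fun k => xi k n.+1 t) (emb c) (emb b).
      apply/stepE => k; have := Bt (k, n.+1); rewrite /B' /= eqxx; apply.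
      by rewrite mem_cat map_f // mem_enum.
    by apply: step_fun st; rewrite -Yc; exact: Yst.
  move=> km ks; have := Bt km; rewrite /B' gtn_eqF ?sn //; apply.
  by rewrite mem_cat ks orbT.
have disj c c' t : F c t -> F c' t -> c = c'.
  rewrite /F; case: ifP => // _ [_ E _]; case: ifP => // _ [_ E' _].
  by apply: emb_inj; rewrite -E -E'.
have [mF PF] := fine_measure_disjoint P (fun c => (FP c).1) disj.
rewrite cylE; split=> //; by rewrite PF (eq_bigr _ (fun c _ => (FP c).2)) -mulr_suml -mulr_sumr.
Qed.

Lemma transition_kernel n b : P [set t | Y 0%N t = emb b0] != 0%E ->
  transition P Y n (emb b0) (emb b) = step_weights n b0 b.
Proof.
move=> P0; rewrite /transition /cond_prob.
have -> : [set t | Y n t = emb b] `&` [set t | Y 0%N t = emb b0] =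
    cylinder n b [::] (fun=> setT).
  by apply/seteqP; split=> t [] // ? ?; split.
have [//|//|_ ->] := @cylinder_prob n b [::] (fun=> setT).
rewrite big_nil mulr1 mulrAC mulfV ?mul1r // fine_eq0 //.
rewrite fin_num_measure //.
case: chain => _ mY0 _ _; apply: mY0; exists [set emb b0] => //; by rewrite setTI.
Qed.

End ChainKernel.

(** * Finite boxes of states and sums over one coordinate *)

Section IntegerBox.
Variables (N M : nat) (L : int).

Definition box_state (b : {ffun 'I_N -> 'I_M}) : state N := [ffun k => L + (b k)%:Z].

Lemma box_stateE b k : box_state b k = L + (b k)%:Z.
Proof. by rewrite ffunE. Qed.

Lemma box_state_inj : injective box_state.
Proof.
move=> b c /ffunP E; apply/ffunP => k; have := E k; rewrite !ffunE => H.
by apply: val_inj => /=; lia.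
Qed.

Lemma box_stateP (z : state N) : (forall k, L <= z k < L + M%:Z) ->
  exists b, box_state b = z.
Proof.
move=> zL; have zM k : (absz (z k - L) < M)%N by have := zL k; lia.
exists [ffun k => Ordinal (zM k)]; apply/ffunP => k; rewrite !ffunE /=.
by have := zL k; lia.
Qed.

Lemma box_state_bounds b k : L <= box_state b k < L + M%:Z.
Proof. by rewrite ffunE; have := ltn_ord (b k); lia. Qed.

Section Sums.
Context (R : pzRingType) (V : lmodType R).
Implicit Types (F : int -> V) (c : int).

Lemma sum_box_telescope F c : L <= c <= L + M%:Z ->
  \sum_(s < M) (L + s%:Z < c)%R%:R *: (F (L + s%:Z + 1) - F (L + s%:Z)) = F c - F L.
Proof.
move=> Lc; pose m := absz (c - L); have mM : (m <= M)%N by lia.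
have cE : c = L + m%:Z by lia.
rewrite (_ : F c - F L = F (L + m%:Z) - F (L + 0%:Z)); last by rewrite -cE addr0.
rewrite -(telescope_sumr (fun s : nat => F (L + s%:Z)) (leq0n m)) big_mkord.
rewrite (big_ord_widen M (fun s : nat => F (L + s.+1%:Z) - F (L + s%:Z)) mM) [RHS]big_mkcond.
apply: eq_bigr => s _; rewrite (_ : (L + s%:Z < c) = (s < m)%N); last by lia.
case: ifP => _; rewrite ?scale0r // scale1r.
by rewrite (_ : L + s%:Z + 1 = L + s.+1%:Z) //; lia.
Qed.

Lemma sum_box_pick F c : c < L + M%:Z -> (c < L -> F c = 0) ->
  \sum_(s < M) (L + s%:Z == c)%:R *: F (L + s%:Z) = F c.
Proof.
move=> cM F0; have [cL|Lc] := ltP c L.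
  rewrite F0 // big1 // => s _; rewrite (_ : (_ == _) = false) ?scale0r //.
  by apply/eqP; lia.
have mM : (absz (c - L) < M)%N by lia.
have cE : L + (absz (c - L))%:Z = c by lia.
rewrite (bigD1 (Ordinal mM)) //= cE eqxx scale1r big1 ?addr0 // => s sm.
rewrite (_ : (_ == _) = false) ?scale0r //.
by apply/eqP => E; case/eqP: sm; apply: val_inj => /=; lia.
Qed.

End Sums.
End IntegerBox.

(** * Ordered states and the determinant at time zero *)

Section StateSpaces.
Variable N : nat.
Implicit Types (z : state N).

Definition Wb z := [forall k : 'I_N, (0 < k)%N ==> (z k <= z (pred_ord k))].
Definition Whatb z := [forall k : 'I_N, (0 < k)%N ==> (z (pred_ord k) <= z k)].

Lemma WhatP z : reflect (What z) (Whatb z).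
Proof.
apply: (iffP forallP) => [H j k|H k]; last first.
  by apply/implyP => k0; apply: H; rewrite /= leq_pred.
move: {2}(k : nat) (leqnn k) => n; elim: n k => [|n IH] k kn jk.
  by rewrite (_ : j = k) //; apply: val_inj => /=; lia.
move: jk; rewrite leq_eqVlt => /orP[/eqP/val_inj -> //|jk].
have k0 : (0 < k)%N by lia.
by apply: le_trans (implyP (H k) k0); apply: IH => /=; lia.
Qed.

Lemma WP z : reflect (W z) (Wb z).
Proof.
apply: (iffP forallP) => [H j k|H k]; last first.
  by apply/implyP => k0; apply: H; rewrite /= leq_pred.
move: {2}(k : nat) (leqnn k) => n; elim: n k => [|n IH] k kn jk.
  by rewrite (_ : j = k) //; apply: val_inj => /=; lia.
move: jk; rewrite leq_eqVlt => /orP[/eqP/val_inj -> //|jk].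
have k0 : (0 < k)%N by lia.
by apply: (le_trans (implyP (H k) k0)); apply: IH => /=; lia.
Qed.

Lemma prod_nat_forall (R : comNzRingType) (A : pred 'I_N) :
  \prod_k (A k)%:R = [forall k, A k]%:R :> R.
Proof.
case: forallP => [H|/forallP/forallPn[k /negPf Ak]].
  by rewrite big1 // => k _; rewrite H.
by rewrite (bigD1 k) //= Ak mul0r.
Qed.

(** With indices from 0, the block has k + 1 rows and N - k columns, one more in total than N. By
    pigeonhole no permutation avoids it, so every Leibniz term vanishes. *)
Lemma det_zero_block (R : comNzRingType) (A : 'M[R]_N) (k : 'I_N) :
  (forall r c : 'I_N, (r <= k)%N -> (k <= c)%N -> A r c = 0) -> \det A = 0.
Proof.
move=> A0; rewrite /determinant big1 // => s _.
suff [i [ik ki]] : exists i : 'I_N, (i <= k)%N /\ (k <= s i)%N.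
  by rewrite (bigD1 i) //= A0 // mul0r mulr0.
apply: contrapT => nex.
pose lek := [set i : 'I_N | (i <= k)%N]%SET; pose ltk := [set i : 'I_N | (i < k)%N]%SET.
have sub : ([set s i | i in lek] \subset ltk)%SET.
  apply/fintype.subsetP => _ /imsetP[i + ->]; rewrite !inE => ik.
  by rewrite ltnNge; apply/negP => ki; apply: nex; exists i.
have /proper_card : ltk \proper lek.
  apply/fintype.properP; split; first by apply/fintype.subsetP => i; rewrite !inE => /ltnW.
  by exists k; rewrite !inE ?leqnn ?ltnn.
by rewrite ltnNge -(card_imset lek (@perm_inj _ s)) subset_leq_card.
Qed.

(** An entry vanishes above the diagonal if y_j <= y'_i, and on or below it if y'_i < y_j. Where y
    and y' differ at k, the orderings spread this over a block with corner (k, k): upper right if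
    y_k < y'_k, lower left otherwise. *)
Lemma det_initial (R : comNzRingType) (g : 'I_N -> 'I_N -> int -> R) (y y' : state N) :
  (forall i x, g i i x = (x == 0)%:R) ->
  (forall i j x, 0 < x -> g i j x = 0) ->
  (forall (i j : 'I_N) x, (j <= i)%N -> x + i%:Z < j%:Z -> g i j x = 0) ->
  W y -> W y' ->
  \det (\matrix_(i < N, j < N) g i j (y' i - y j - i%:Z + j%:Z)) = (y == y')%:R.
Proof.
move=> gxx gh gl Wy Wy'.
have zero (i j : 'I_N) : (if (j <= i)%N then y' i < y j else y j <= y' i) ->
    g i j (y' i - y j - i%:Z + j%:Z) = 0.
  by case: leqP => ji H; [apply: gl => //; lia | apply: gh; lia].
have [yy'|/eqP ne] := eqVneq y y'.
  rewrite -yy' in zero *; rewrite det_trig; last first.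
    apply/is_trig_mxP => i j ij; rewrite mxE zero // leqNgt ij.
    by apply: Wy; exact: ltnW.
  by rewrite big1 // => i _; rewrite mxE gxx (_ : _ == 0) //; apply/eqP; lia.
have [k /eqP yk] : exists k, y k != y' k.
  by apply/existsP; apply: contra_notT ne => /existsPn H; apply/ffunP => k; apply/eqP/negPn.
have [kk|kk] : y k < y' k \/ y' k < y k by lia.
  apply: (@det_zero_block _ _ k) => r c rk kc; rewrite mxE.
  have := Wy _ _ kc; have := Wy' _ _ rk => yr yc.
  have [cr|rc] := leqP c r; last by apply: zero; rewrite leqNgt rc /=; lia.
  have rE : r = k by apply: val_inj => /=; lia.
  have cE : c = k by apply: val_inj => /=; lia.
  by rewrite rE cE gxx (_ : (_ == 0) = false) //; apply/eqP; lia.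
rewrite -det_tr; apply: (@det_zero_block _ _ k) => c r ck kr; rewrite !mxE.
have := Wy _ _ ck; have := Wy' _ _ kr => yr yc.
by apply: zero; rewrite (leq_trans ck kr); lia.
Qed.

End StateSpaces.

(** * Probabilities of noise events *)

Section Noise.
Context d (T : measurableType d) (R : realType) (P : probability T R).
Implicit Type X : {RV P >-> nat}.

Lemma measurable_nat_preimage X (B : set nat) : measurable (X @^-1` B).
Proof. exact: measurable_funPTI. Qed.

Let probU (A B : set T) : measurable A -> measurable B ->
  (forall t, A t -> B t -> False) -> P (A `|` B) = (P A + P B)%E.
Proof.
move=> mA mB AB; apply: measureU => //; apply/seteqP; split=> t // [At Bt].
exact: AB At Bt.
Qed.

(** Needed for a jump stopped by a barrier in case C: all noise values from the gap upwards give the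
    same position. *)
Lemma geometric_tail X (p : R) m :
  (forall r : nat, P [set t | X t = r] = ((1 - p) * p ^+ r)%:E) ->
  P (X @^-1` [set r | (m <= r)%N]) = (p ^+ m)%:E.
Proof.
move=> geo; elim: m => [|m IH].
  by rewrite (_ : _ @^-1` _ = setT) ?probability_setT ?expr0 //; apply/seteqP; split.
have E : X @^-1` [set r | (m <= r)%N] =
    [set t | X t = m] `|` X @^-1` [set r | (m < r)%N].
  apply/seteqP; split=> t /=.
    by rewrite leq_eqVlt => /orP[/eqP ->|]; [left|right].
  by case=> [->//|/ltnW].
move: IH; rewrite E probU; first last.
- by move=> t /= ->; rewrite ltnn.
- exact: measurable_nat_preimage.
- exact: (measurable_nat_preimage X [set m]).
rewrite geo => H.
have finP : P (X @^-1` [set r | (m < r)%N]) \is a fin_num.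
  by rewrite fin_num_measure //; exact: measurable_nat_preimage.
move: H; rewrite -(fineK finP) -EFinD => -[H]; congr (_%:E).
by rewrite exprS; move: H; lra.
Qed.

(** The noise takes values in [nat]; the event of a value above 1 is null because the two prescribed
    probabilities already add up to one. *)
Lemma bernoulli_preimage X (p : R) (B : pred nat) :
  P [set t | X t = 1%N] = p%:E -> P [set t | X t = 0%N] = (1 - p)%:E ->
  P (X @^-1` [set r | B r]) = ((B 0%N)%:R * (1 - p) + (B 1%N)%:R * p)%:E.
Proof.
move=> P1 P0.
pose C := X @^-1` [set r | (1 < r)%N].
have mC : measurable C by exact: measurable_nat_preimage.
have mX r : measurable [set t | X t = r] by exact: (measurable_nat_preimage X [set r]).
have PC : P C = 0%E.
  have : P (C `|` ([set t | X t = 1%N] `|` [set t | X t = 0%N])) = 1%E.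
    rewrite -(probability_setT P); congr (P _); apply/seteqP; split=> t // _.
    by rewrite /C /=; case: (X t) => [|[|r]]; [right; right|right; left|left].
  rewrite probU //; last 2 first.
  - exact: measurableU.
  - by rewrite /C => t /= + [] E; rewrite E.
  rewrite probU //; last by move=> t /= ->.
  rewrite P1 P0 -EFinD subrKC => H.
  have finP : P C \is a fin_num by rewrite fin_num_measure.
  move: H; rewrite -(fineK finP) -EFinD => -[H]; congr (_%:E); move: H; lra.
have part r : P ([set t | X t = r] `&` X @^-1` [set r | B r]) =
    ((B r)%:R%:E * P [set t | X t = r])%E.
  case Br : (B r).
    rewrite mul1e; congr (P _); apply/seteqP; split=> t /=; first by case.
    by move=> Xt; rewrite Xt.
  rewrite mul0e (_ : _ `&` _ = set0) ?measure0 //; apply/seteqP; split=> t //= -[->].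
  by rewrite Br.
have -> : X @^-1` [set r | B r] =
    (C `&` X @^-1` [set r | B r]) `|`
    (([set t | X t = 0%N] `&` X @^-1` [set r | B r]) `|`
     ([set t | X t = 1%N] `&` X @^-1` [set r | B r])).
  apply/seteqP; split=> t /=; last by case=> [[]|[[]|[]]].
  by rewrite /C /=; case: (X t) => [|[|r]]; [right; left|right; right|left].
have mI r : measurable ([set t | X t = r] `&` X @^-1` [set r | B r]).
  by apply: measurableI => //; exact: measurable_nat_preimage.
have mCI : measurable (C `&` X @^-1` [set r | B r]).
  by apply: measurableI => //; exact: measurable_nat_preimage.
rewrite probU //; last 2 first.
- exact: measurableU.
- by rewrite /C => t /= [+ _] [[E _]|[E _]]; rewrite E.
rewrite probU //; last by move=> t /= [-> _] [].
rewrite !part P0 P1 -!EFinM -EFinD.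
rewrite (_ : P (C `&` _) = 0%E) ?add0e //.
apply/eqP; rewrite eq_le measure_ge0 andbT -PC.
by apply: le_measure; rewrite ?inE //; exact: subIsetl.
Qed.

End Noise.

(** * Nondecreasing chains on a box *)

Section BoxKernel.
Context d (T : measurableType d) (R : realType) (P : probability T R) (N : nat).
Variables (S : pred (state N)) (step : step_type N).
Variable loc : 'I_N -> nat -> state N -> state N -> bool.
Variable wt : 'I_N -> state N -> state N -> R.
Variables (xi : 'I_N -> nat -> {RV P >-> nat}) (Y : nat -> T -> state N).

Hypothesis stepE : forall u x z, step u x z <-> forall k, loc k (u k) x z.
Hypothesis stepS : forall u x z, S x -> step u x z -> S z /\ forall k, x k <= z k.
Hypothesis step_fun : forall u x z z', step u x z -> step u x z' -> z = z'.
Hypothesis wtE : forall k m x z, (1 <= m)%N -> S x -> S z ->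
  P (xi k m @^-1` [set r | loc k r x z]) = (wt k x z)%:E.
Hypothesis chain : is_chain S step xi Y.

(** Coordinates never decrease, so a path that starts in the box and is in it at time m + 1 is
    squeezed inside it at time m. *)
Lemma transition_box_kernel (L : int) (M : nat) n (b0 b : {ffun 'I_N -> 'I_M}) :
  P [set t | Y 0%N t = box_state L b0] != 0%E ->
  transition P Y n (box_state L b0) (box_state L b) = step_weights S wt (box_state L) n b0 b.
Proof.
have stepS1 u x z : S x -> step u x z -> S z by move=> Sx /(stepS Sx)[].
have YS n' t : S (Y n' t) by exact: (chain_S stepS1 chain).
have [_ _ _ Yst] := chain.
apply: (transition_kernel stepE stepS1 step_fun wtE chain) => //.
  exact: box_state_inj.
move=> m t Y0 [c Yc].
have mono k : box_state L b0 k <= Y m t k.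
  rewrite -Y0; elim: m {c Yc} => // m IH.
  by apply: le_trans IH _; exact: (stepS (YS m t) (Yst m t)).2.
suff [e eE] : exists e : {ffun 'I_N -> 'I_M}, box_state L e = Y m t by exists e.
apply: box_stateP => k.
have := (stepS (YS m t) (Yst m t)).2 k; rewrite Yc.
have := box_state_bounds L c k; have := box_state_bounds L b0 k; have := mono k.
by lia.
Qed.

End BoxKernel.

(** * The forward equation for pushing *)

Section ForwardEquation.
Context (R : realType) (N M : nat) (L : int) (y : state N).
Variables (p rho : 'I_N -> R) (g : nat -> 'I_N -> 'I_N -> int -> R).
Variable lw : 'I_N -> int -> int -> int -> R.
Hypothesis rho0 : forall k, rho k != 0.
Hypothesis y_low : forall k, L + N%:Z <= y k.
Hypothesis g_row : forall n (i j : 'I_N) x, (0 < i)%N ->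
  g n i j x = g n (pred_ord i) j x - (rho i)^-1 * g n (pred_ord i) j (x - 1).
Hypothesis g_low : forall n i j x, x < 0 -> g n i j x = 0.

Definition hat_row n (k : 'I_N) (z : int) : 'rV[R]_N :=
  \row_j g n k j (z - y j + k%:Z - j%:Z).

Definition hat_formula n (z : state N) : R :=
  (\prod_k ((1 - p k) ^+ n * rho k ^ (z k - y k))) *
  \det (\matrix_(i < N, j < N) g n i j (z i - y j + i%:Z - j%:Z)).

Lemma hat_row_pred n (k : 'I_N) z : (0 < k)%N ->
  hat_row n k z = hat_row n (pred_ord k) (z + 1) - (rho k)^-1 *: hat_row n (pred_ord k) z.
Proof.
move=> k0; apply/rowP => j; rewrite !mxE g_row //=.
by congr (g _ _ _ _ - _ * g _ _ _ _); lia.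
Qed.

(** The margin [N] below [y] absorbs the index shift [k - j], so every argument is negative at the
    bottom of the box. *)
Lemma hat_row_low n k z : z <= L -> hat_row n k z = 0.
Proof.
move=> zL; apply/rowP => j; rewrite !mxE g_low //.
by have := y_low j; have := ltn_ord k; lia.
Qed.

(** By [hat_row_pred], rho_k^z times row k at z is the increment from z to z + 1 of rho_k^(z - 1)
    times row k - 1; the sum telescopes and its lower end vanishes. *)
Lemma hat_row_geometric n (k : 'I_N) c : (0 < k)%N -> L <= c <= L + M%:Z ->
  \sum_(s < M) ((L + s%:Z < c)%R%:R * rho k ^ (L + s%:Z)) *: hat_row n k (L + s%:Z) =
  rho k ^ (c - 1) *: hat_row n (pred_ord k) c.
Proof.
move=> k0 Lc.
have := sum_box_telescope (fun z => rho k ^ (z - 1) *: hat_row n (pred_ord k) z) Lc.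
rewrite (hat_row_low n (pred_ord k) (lexx L)) scaler0 subr0 => <-.
apply: eq_bigr => s _; move: (L + s%:Z) => z.
by rewrite addrK hat_row_pred // !scalerBr !scalerA expfzDr // exprN1 !mulrA.
Qed.

(* Without the constraint [z (k - 1) <= z k] the sum over [z k] would only produce
   [hat_row n.+1] terms; by [hat_row_geometric] the excluded terms add up to a
   multiple of the row [k - 1] at [z (k - 1)], which is the [c'] term. *)
Lemma hat_formula_step (s0 : 'I_M) (b : {ffun 'I_N -> 'I_M}) n
    (c : 'I_N -> R) (c' : 'I_N -> 'I_M -> R) :
  let z' := box_state L b in
  What z' ->
  (forall k x zp, z' k < x -> lw k x zp (z' k) = 0) ->
  (forall (k : 'I_N) (t : 'I_M), ((0 < k)%N -> L + t%:Z <= z' (pred_ord k)) ->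
    \sum_(s < M) (rho k ^ (L + s%:Z - z' k) * lw k (L + s%:Z) (z' (pred_ord k)) (z' k) *
       ((0 < k)%N ==> (t <= s)%N)%:R) *: hat_row n k (L + s%:Z) =
    (1 - p k) *: (hat_row n.+1 k (z' k) + (0 < k)%N%:R *:
       (c k *: hat_row n.+1 (pred_ord k) (z' (pred_ord k)) +
        c' k t *: hat_row n (pred_ord k) (L + t%:Z)))) ->
  \sum_(e : {ffun 'I_N -> 'I_M}) hat_formula n (box_state L e) *
    step_weight (@Whatb N) (fun k x z => lw k (x k) (z (pred_ord k)) (z k)) (box_state L e) z' =
  hat_formula n.+1 z'.
Proof.
move=> z' /WhatP Wz' lw0 Hs.
(* The prefactor splits at z': [K] keeps rho_k^(z'_k - y_k) and the weights take rho_k^(z_k - z'_k).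
   The ordering of the summed state is spread over the factors as one indicator per coordinate. *)
pose w (k : 'I_N) (t s : 'I_M) : R := rho k ^ (L + s%:Z - z' k) *
  lw k (L + s%:Z) (z' (pred_ord k)) (z' k) * ((0 < k)%N ==> (t <= s)%N)%:R.
pose K := \prod_k ((1 - p k) ^+ n * rho k ^ (z' k - y k)).
transitivity (\sum_(e : {ffun 'I_N -> 'I_M}) K * ((\prod_k w k (e (pred_ord k)) (e k)) *
    det_rows (fun k => hat_row n k (L + (e k)%:Z)))).
  apply: eq_bigr => e _; rewrite /hat_formula /step_weight Wz' andbT.
  have -> : \matrix_(i < N, j < N) g n i j (box_state L e i - y j + i%:Z - j%:Z) =
      \matrix_k hat_row n k (L + (e k)%:Z).
    by apply/matrixP => i j; rewrite !mxE box_stateE.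
  rewrite /det_rows mulrAC !mulrA; congr (_ * _).
  have -> : \prod_k w k (e (pred_ord k)) (e k) =
      (\prod_k (rho k ^ (box_state L e k - z' k) *
         lw k (box_state L e k) (z' (pred_ord k)) (z' k))) * (Whatb (box_state L e))%:R.
    rewrite /w big_split /=; congr (_ * _).
      by apply: eq_bigr => k _; rewrite box_stateE.
    rewrite prod_nat_forall; congr (_ %:R); congr (nat_of_bool _).
    by apply: eq_forallb => k; rewrite !box_stateE lerD2l.
  case: ifP => _; last by rewrite !mulr0.
  rewrite mulr1 -!big_split /=; apply: eq_bigr => k _.
  rewrite (_ : box_state L e k - y k = (z' k - y k) + (box_state L e k - z' k)); last by lia.
  by rewrite expfzDr //; ring.
rewrite -mulr_sumr.
rewrite (@det_rows_sweep _ _ _ w (fun k s => hat_row n k (L + s%:Z))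
   (fun k => hat_row n.+1 k (z' k))
   (fun k => 1 - p k) c c' (fun k s => L + s%:Z <= z' k) _ _ _ s0) //; last first.
- by move=> k t s _; rewrite -ltNge => ks; rewrite /w lw0 // mulr0 mul0r.
- by move=> k t t' s k0; rewrite /w k0.
rewrite /hat_formula mulrA /K -big_split /=; congr (_ * _).
  by apply: eq_bigr => k _; rewrite exprSr; ring.
by congr (\det _); apply/matrixP => i j; rewrite !mxE.
Qed.

End ForwardEquation.

Lemma exprz_absM (R : realType) (r : R) (x y : int) z : r != 0 -> x <= y ->
  r ^ z * r ^+ absz (y - x) = r ^ (z + (y - x)).
Proof.
move=> r0 xy; rewrite -[r ^+ _]/(r ^ (absz (y - x))%:Z) -expfzDr //.
by congr (_ ^ (_ + _)); lia.
Qed.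

(** * One forward step in cases A and D *)

Section PushingCases.
Context (R : realType) (N M : nat) (L : int) (y : state N).
Variables (p rho : 'I_N -> R) (g : nat -> 'I_N -> 'I_N -> int -> R).
Hypothesis p01 : forall k, 0 < p k < 1.
Hypothesis y_low : forall k, L + N%:Z <= y k.
Hypothesis g_low : forall n i j x, x < 0 -> g n i j x = 0.

(* The law of coordinate [k] in one step; [x] or [xk] and [zk] are its positions
   before and after the step, [xp] and [zp] those of coordinate [k - 1]. *)
Definition weightA (k : 'I_N) (x zp zk : int) : R :=
  let lo := if (k == 0%N :> nat) then x else Num.max x zp in
  if lo <= zk then (1 - p k) * p k ^+ absz (zk - lo) else 0.

Definition weightD (k : 'I_N) (x zp zk : int) : R :=
  let push r := if (k == 0%N :> nat) then x + r else Num.max (x + r) zp in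
  (zk == push 0)%:R * (1 - p k) + (zk == push 1)%:R * p k.

Let p0 k : p k != 0. Proof. by have := p01 k; lra. Qed.

(** Let B and A be the new positions of coordinates k and k - 1. Up to 1 - p_k, an old position z
    has combined weight 1 for A < z <= B and p_k^(z - A) for t <= z <= A. The first range telescopes
    to line k for n + 1 at B minus the same line at A; the second, by [hat_row_geometric], to line k
    - 1 for n at A + 1 minus p_k^(t - 1 - A) times that line at t. The terms at A and A + 1 combine
    to 1/p_k - 1 times line k - 1 for n + 1 at A. This gives [c] and [c']. *)
Lemma formulaA_step (s0 : 'I_M) (b : {ffun 'I_N -> 'I_M}) n :
  (forall n (i j : 'I_N) x, (0 < i)%N ->
    g n i j x = g n (pred_ord i) j x - (p i)^-1 * g n (pred_ord i) j (x - 1)) ->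
  (forall n i j x, g n i j x = g n.+1 i j x - g n.+1 i j (x - 1)) ->
  What (box_state L b) ->
  \sum_(e : {ffun 'I_N -> 'I_M}) hat_formula y p p g n (box_state L e) *
    step_weight (@Whatb N) (fun k x z => weightA k (x k) (z (pred_ord k)) (z k))
      (box_state L e) (box_state L b) =
  hat_formula y p p g n.+1 (box_state L b).
Proof.
move=> g_row g_rec Wb.
pose V n := hat_row y g n.
have Vrec m k z : V m k z = V m.+1 k z - V m.+1 k (z - 1).
  apply/rowP => j; rewrite !mxE g_rec; congr (_ - g _ _ _ _); lia.
have Vlow m k z : z <= L -> V m k z = 0 by exact: hat_row_low.
have Vsum m k c : L <= c <= L + M%:Z ->
    \sum_(s < M) (L + s%:Z < c)%R%:R *: V m k (L + s%:Z) = V m.+1 k (c - 1).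
  move=> Lc; have := sum_box_telescope (fun z => V m.+1 k (z - 1)) Lc.
  rewrite (Vlow _ _ (L - 1)) ?subr0 => [<-|]; last by lia.
  by apply: eq_bigr => s _; rewrite addrK -Vrec.
apply: (hat_formula_step p0 s0
  (c := fun k => (p k)^-1 - 1)
  (c' := fun k t => - p k ^ (L + t%:Z - 1 - box_state L b (pred_ord k)))) => //.
  move=> k x zp; rewrite /weightA => bx; case: ifP => // H; exfalso; move: H bx.
  by case: ifP => _; lia.
move=> k t; set B := box_state L b k; set A := box_state L b (pred_ord k).
have LB := box_state_bounds L b k; have LA := box_state_bounds L b (pred_ord k).
rewrite -/A -/B in LA LB *.
case: (posnP k) => k0 ok.
  rewrite scale0r addr0.
  transitivity (\sum_(s < M) (1 - p k) *: ((L + s%:Z < B + 1)%R%:R *: V n k (L + s%:Z))).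
    apply: eq_bigr => s _; rewrite /weightA k0 /= mulr1 scalerA; congr (_ *: _).
    move: (L + s%:Z) => z; rewrite ltzD1.
    case: ifP => zB; last by rewrite !mulr0.
    by rewrite mulrCA exprz_absM // (_ : z - B + (B - z) = 0); last lia.
  rewrite -scaler_sumr Vsum; last by lia.
  by rewrite addrK.
have TA := ok isT.
have AB : A <= B by apply: Wb; rewrite /= leq_pred.
rewrite scale1r.
pose q (c : int) (s : 'I_M) := (L + s%:Z < c)%R%:R *: V n k (L + s%:Z).
pose h (c : int) (s : 'I_M) := ((L + s%:Z < c)%R%:R * p k ^ (L + s%:Z)) *: V n k (L + s%:Z).
pose i (c : int) (s : 'I_M) : R := (L + s%:Z < c)%R%:R.
(* Both ranges are written as differences of initial segments z < c, the form in which [Vsum] and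
   [hat_row_geometric] apply. *)
transitivity (\sum_(s < M) ((1 - p k) * (i (B + 1) s - i (A + 1) s + p k ^ (- A) *
    (i (A + 1) s * p k ^ (L + s%:Z) - i (L + t%:Z) s * p k ^ (L + s%:Z)))) *: V n k (L + s%:Z)).
  apply: eq_bigr => s _; rewrite /i /weightA gtn_eqF //=; congr (_ *: _).
  rewrite (_ : (t <= s)%N = (L + t%:Z <= L + s%:Z)); last by rewrite lerD2l.
  move: (L + s%:Z) (L + t%:Z) TA => z t' TA; rewrite !ltzD1 maxEle.
  have [zt|tz] := leP t' z; last first.
    have zA : z <= A by lia.
    have zB : z <= B by lia.
    by rewrite zA zB mulr0 !subrr mulr0 addr0 mulr0.
  have [zA|Az] := leP z A.
    have zB : z <= B by lia.
    rewrite zB AB mulr1 mulrCA exprz_absM //= subrr add0r !mul1r mul0r subr0.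
    by rewrite -expfzDr //; congr (_ * _ ^ _); lia.
  rewrite !mul0r subrr mulr0 addr0 subr0 mulr1.
  case: ifP => zB; last by rewrite !mulr0.
  by rewrite mulrCA exprz_absM // (_ : z - B + (B - z) = 0) //; lia.
transitivity (\sum_(s < M) (1 - p k) *:
    (q (B + 1) s - q (A + 1) s + p k ^ (- A) *: (h (A + 1) s - h (L + t%:Z) s))).
  apply: eq_bigr => s _; rewrite -scalerA; congr (_ *: _).
  by rewrite scalerDl -scalerA !scalerBl.
rewrite -scaler_sumr big_split /= sumrB -scaler_sumr sumrB.
rewrite !Vsum; [|lia|lia].
rewrite !(hat_row_geometric p0 y_low g_row g_low) //; [|lia|lia].
rewrite !addrK; congr (_ *: _).
have := hat_row_pred y g_row n.+1 A k0; have := Vrec n (pred_ord k) (A + 1).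
rewrite -/(V n.+1) -/(V n) addrK => -> ->.
rewrite scalerBr !scalerA -expfzDr // (_ : - A + A = 0) ?expr0z ?scale1r; last by lia.
rewrite -expfzDr // (_ : - A + (L + t%:Z - 1) = L + t%:Z - 1 - A); last by lia.
move: (V n.+1 k B) (V n.+1 _ (A + 1)) (V n.+1 _ A) (V n _ _) => v1 v2 v3 v4.
by apply/rowP => j; rewrite !mxE; ring.
Qed.

(** If A < B the old position is B or B - 1, hence at least A: no push occurred and the free
    recursion applies. If A = B every admissible z < A is brought to A with certainty;
    [hat_row_geometric] sums these terms, and 1 + 1/rho_k = 1/p_k makes the rest match. *)
Lemma formulaD_step (s0 : 'I_M) (b : {ffun 'I_N -> 'I_M}) n :
  (forall k, rho k = p k / (1 - p k)) ->
  (forall n (i j : 'I_N) x, (0 < i)%N ->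
    g n i j x = g n (pred_ord i) j x - (rho i)^-1 * g n (pred_ord i) j (x - 1)) ->
  (forall n i j x, g n.+1 i j x = g n i j x + g n i j (x - 1)) ->
  What (box_state L b) ->
  \sum_(e : {ffun 'I_N -> 'I_M}) hat_formula y p rho g n (box_state L e) *
    step_weight (@Whatb N) (fun k x z => weightD k (x k) (z (pred_ord k)) (z k))
      (box_state L e) (box_state L b) =
  hat_formula y p rho g n.+1 (box_state L b).
Proof.
move=> rhoE g_row g_rec Wb.
have rho0 k : rho k != 0.
  by rewrite rhoE mulf_neq0 // invr_eq0; have := p01 k; lra.
have rhoVp k : (rho k)^-1 * p k = 1 - p k.
  by rewrite rhoE; field; have := p01 k; lra.
pose V n := hat_row y g n.
have Vrec m k z : V m.+1 k z = V m k z + V m k (z - 1).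
  apply/rowP => j; rewrite !mxE g_rec; congr (_ + g _ _ _ _); lia.
have Vlow m k z : z <= L -> V m k z = 0 by exact: hat_row_low.
have Vpick m k c : c < L + M%:Z ->
    \sum_(s < M) (L + s%:Z == c)%:R *: V m k (L + s%:Z) = V m k c.
  by move=> cM; apply: (sum_box_pick (F := V m k)) => // /ltW; exact: Vlow.
apply: (hat_formula_step rho0 s0
  (c := fun k => if box_state L b (pred_ord k) < box_state L b k then 0 else (rho k)^-1)
  (c' := fun k t => if box_state L b (pred_ord k) < box_state L b k then 0 else
    - (rho k ^ (L + t%:Z - 1 - box_state L b (pred_ord k)) / (1 - p k)))) => //.
  move=> k x zp; rewrite /weightD => bx; set u0 := (_ == _); set u1 := (_ == _).
  have -> : u0 = false by apply/negP => /eqP; case: ifP => _; lia.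
  have -> : u1 = false by apply/negP => /eqP; case: ifP => _; lia.
  by rewrite !mul0r addr0.
move=> k t; set B := box_state L b k; set A := box_state L b (pred_ord k).
have LB := box_state_bounds L b k; have LA := box_state_bounds L b (pred_ord k).
rewrite -/A -/B in LA LB *.
have free : (forall s : 'I_M, rho k ^ (L + s%:Z - B) * weightD k (L + s%:Z) A B *
      ((0 < k)%N ==> (t <= s)%N)%:R =
      (1 - p k) * ((L + s%:Z == B)%:R + (L + s%:Z == B - 1)%:R)) ->
    \sum_(s < M) (rho k ^ (L + s%:Z - B) * weightD k (L + s%:Z) A B *
      ((0 < k)%N ==> (t <= s)%N)%:R) *: V n k (L + s%:Z) = (1 - p k) *: V n.+1 k B.
  move=> H; rewrite (eq_bigr (fun s : 'I_M =>
      (1 - p k) *: ((L + s%:Z == B)%:R *: V n k (L + s%:Z) +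
        (L + s%:Z == B - 1)%:R *: V n k (L + s%:Z)))); last first.
    by move=> s _; rewrite H -scalerA; congr (_ *: _); rewrite scalerDl.
  by rewrite -scaler_sumr big_split /= !Vpick -?Vrec //; lia.
have wfree z : rho k ^ (z - B) * ((B == z)%:R * (1 - p k) + (B == z + 1)%:R * p k) =
    (1 - p k) * ((z == B)%:R + (z == B - 1)%:R).
  rewrite ![B == _]eq_sym; have [->|zB] := eqVneq z B.
    have -> : (B + 1 == B) = false by lia.
    have -> : (B == B - 1) = false by lia.
    by rewrite subrr expr0z mul0r !addr0 !mul1r mulr1.
  rewrite (_ : (z == B - 1) = (z + 1 == B)); last by apply/eqP/eqP; lia.
  have [zB1|_] := eqVneq (z + 1) B; last by rewrite !mul0r !add0r !mulr0.
  by rewrite (_ : z - B = -1) ?exprN1; [rewrite mul0r !add0r mul1r mulr1|lia].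
move=> ok; have [k0|k0] : k = 0%N :> nat \/ (0 < k)%N by lia.
  have k0' : (0 < k)%N = false by rewrite k0.
  rewrite [in RHS]k0' scale0r addr0; apply: free => s.
  by rewrite k0 /= mulr1 /weightD k0 /= addr0.
have TA := ok k0; rewrite -/A in TA.
have AB : A <= B by apply: Wb; rewrite /= leq_pred.
have wE z t' : t' <= A -> rho k ^ (z - B) * weightD k z A B * (t' <= z)%R%:R =
  if A < B then (1 - p k) * ((z == B)%:R + (z == B - 1)%:R)
  else (1 - p k) * (z == A)%:R + rho k ^ (- A) *
     ((z < A)%R%:R * rho k ^ z - (z < t')%R%:R * rho k ^ z).
  move=> t'A; rewrite /weightD gtn_eqF //= addr0.
  case: ifP => AltB.
    rewrite -wfree !maxEle; have [zA|Az] := leP z A; last first.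
      have -> : (z + 1 <= A) = false by lia.
      by have -> : t' <= z; [lia|rewrite mulr1].
    have -> : (B == A) = false by lia.
    have -> : (B == z) = false by lia.
    have [zA1|Az1] := leP (z + 1) A; last by have -> : t' <= z; [lia|rewrite mulr1].
    have -> : (B == A) = false by lia.
    have -> : (B == z + 1) = false by lia.
    by rewrite !mul0r add0r mulr0 mul0r.
  have -> : B = A by lia.
  rewrite !maxEle; have [zA|Az|->] := ltgtP z A.
  - have -> : z + 1 <= A by lia.
    rewrite eqxx !mul1r mulr0 add0r subrK mulr1.
    have [t'z|zt'] := leP t' z; last by rewrite mulr0 mul1r subrr mulr0.
    by rewrite mulr1 mul0r subr0 -expfzDr // addrC.
  - have -> : (A == z) = false by lia.
    have -> : (z + 1 <= A) = false by lia.
    have -> : (A == z + 1) = false by lia.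
    have -> : (z < t') = false by lia.
    by rewrite !mul0r subrr !mulr0 !addr0 mulr0 mul0r.
  have -> : (A + 1 <= A) = false by lia.
  have -> : (A == A + 1) = false by lia.
  have -> : (A < t') = false by lia.
  by rewrite t'A eqxx subrr expr0z !mul0r subrr !mulr0 !addr0 !mul1r !mulr1.
have tsE (s : 'I_M) : ((0 < k)%N ==> (t <= s)%N) = (L + t%:Z <= L + s%:Z).
  by rewrite k0 lerD2l.
rewrite [in RHS]k0 scale1r; have [AltB|BA] := ltP A B.
  rewrite !scale0r !addr0; apply: free => s.
  by rewrite tsE wE // AltB.
have {BA} BA : B = A by lia.
pose h (c : int) (s : 'I_M) := ((L + s%:Z < c)%R%:R * rho k ^ (L + s%:Z)) *: V n k (L + s%:Z).
transitivity (\sum_(s < M) ((1 - p k) *: ((L + s%:Z == A)%:R *: V n k (L + s%:Z)) +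
    rho k ^ (- A) *: (h A s - h (L + t%:Z) s))).
  apply: eq_bigr => s _; rewrite tsE wE // BA ltxx [LHS]scalerDl -!scalerA;
    congr (_ + _ *: _); exact: scalerBl.
rewrite big_split /= -!scaler_sumr sumrB Vpick; last by lia.
rewrite !(hat_row_geometric rho0 y_low g_row g_low) //; [|lia|lia].
rewrite -/(V n) -/(V n.+1) BA !Vrec.
have := hat_row_pred y g_row n (A - 1) k0; rewrite subrK -/(V n) => ->.
rewrite scalerBr !scalerA -!expfzDr // (_ : - A + (A - 1) = -1) ?exprN1; last by lia.
rewrite (_ : - A + (L + t%:Z - 1) = L + t%:Z - 1 - A); last by lia.
move: (V n k A) (V n _ A) (V n _ (A - 1)) (V n _ (L + _)) (rho k ^ (_ - A)) => v1 v2 v3 v4 c.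
apply/rowP => j; rewrite !mxE rhoE; field.
by have := p01 k; lra.
Qed.

End PushingCases.

(** * The backward equation and one step in cases B and C *)

Section BackwardEquation.
Context (R : realType) (N M : nat) (L : int) (y' : state N).
Variables (p rho : 'I_N -> R) (g : nat -> 'I_N -> 'I_N -> int -> R).
Hypothesis rho0 : forall k, rho k != 0.
Hypothesis g_col : forall n (i j : 'I_N) x, (0 < j)%N ->
  g n i (pred_ord j) x = g n i j x - rho j * g n i j (x + 1).

Definition start_col n (k : 'I_N) (z : int) : 'rV[R]_N :=
  \row_i g n i k (y' i - z - i%:Z + k%:Z).

Definition blocking_formula n (z : state N) : R :=
  (\prod_k ((1 - p k) ^+ n * rho k ^ (y' k - z k))) *
  \det (\matrix_(i < N, j < N) g n i j (y' i - z j - i%:Z + j%:Z)).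

Lemma start_col_pred n (k : 'I_N) z : (0 < k)%N ->
  start_col n (pred_ord k) z = start_col n k (z + 1) - rho k *: start_col n k z.
Proof.
move=> k0; apply/rowP => i; rewrite !mxE g_col //=.
by congr (g _ _ _ _ - _ * g _ _ _ _); lia.
Qed.

(** The summed state is the one after the first step, so it moves the columns of the determinant,
    which are swept as rows of the transpose. The weight of [z_k] may now depend on the new position
    of coordinate k - 1. *)
Lemma blocking_formula_step (lw : 'I_N -> int -> int -> int -> int -> R) (s0 : 'I_M)
    (b : {ffun 'I_N -> 'I_M}) n (c : 'I_N -> R) (c' : 'I_N -> 'I_M -> R) :
  let x := box_state L b in
  W x ->
  (forall (k : 'I_N) xk xp zp zp' zk, k = 0%N :> nat -> lw k xk xp zp zk = lw k xk xp zp' zk) ->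
  (forall (k : 'I_N) t z, ((0 < k)%N -> x (pred_ord k) <= t) -> z < x k ->
    lw k (x k) (x (pred_ord k)) t z = 0) ->
  (forall (k : 'I_N) (t : 'I_M), ((0 < k)%N -> x (pred_ord k) <= L + t%:Z) ->
    \sum_(s < M) (rho k ^ (x k - (L + s%:Z)) *
       lw k (x k) (x (pred_ord k)) (L + t%:Z) (L + s%:Z) *
       ((0 < k)%N ==> (s <= t)%N)%:R) *: start_col n k (L + s%:Z) =
    (1 - p k) *: (start_col n.+1 k (x k) + (0 < k)%N%:R *:
       (c k *: start_col n.+1 (pred_ord k) (x (pred_ord k)) +
        c' k t *: start_col n (pred_ord k) (L + t%:Z)))) ->
  \sum_(e : {ffun 'I_N -> 'I_M})
    step_weight (@Wb N)
      (fun k x z => lw k (x k) (x (pred_ord k)) (z (pred_ord k)) (z k)) x (box_state L e) *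
    blocking_formula n (box_state L e) =
  blocking_formula n.+1 x.
Proof.
move=> x /WP Wx lw_first lw0 Hs.
pose w (k : 'I_N) (t s : 'I_M) : R := rho k ^ (x k - (L + s%:Z)) *
  lw k (x k) (x (pred_ord k)) (L + t%:Z) (L + s%:Z) * ((0 < k)%N ==> (s <= t)%N)%:R.
pose K := \prod_k ((1 - p k) ^+ n * rho k ^ (y' k - x k)).
transitivity (\sum_(e : {ffun 'I_N -> 'I_M}) K * ((\prod_k w k (e (pred_ord k)) (e k)) *
    det_rows (fun k => start_col n k (L + (e k)%:Z)))).
  apply: eq_bigr => e _; rewrite /blocking_formula /step_weight Wx /=.
  have -> : \matrix_(i < N, j < N) g n i j (y' i - box_state L e j - i%:Z + j%:Z) =
      (\matrix_k start_col n k (L + (e k)%:Z))^T.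
    by apply/matrixP => i j; rewrite !mxE box_stateE.
  rewrite det_tr /det_rows !mulrA; congr (_ * _); rewrite mulrC.
  have -> : \prod_k w k (e (pred_ord k)) (e k) =
      (\prod_k (rho k ^ (x k - box_state L e k) *
         lw k (x k) (x (pred_ord k)) (box_state L e (pred_ord k)) (box_state L e k))) *
      (Wb (box_state L e))%:R.
    rewrite /w big_split /=; congr (_ * _).
      by apply: eq_bigr => k _; rewrite !box_stateE.
    rewrite prod_nat_forall; congr (_ %:R); congr (nat_of_bool _).
    by apply: eq_forallb => k; rewrite !box_stateE lerD2l.
  case: ifP => _; last by rewrite !mulr0.
  rewrite mulr1 -!big_split /=; apply: eq_bigr => k _.
  rewrite (_ : y' k - box_state L e k = (y' k - x k) + (x k - box_state L e k)); last by lia.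
  by rewrite expfzDr //; ring.
rewrite -mulr_sumr.
rewrite (@det_rows_sweep _ _ _ w (fun k s => start_col n k (L + s%:Z))
   (fun k => start_col n.+1 k (x k)) (fun k => 1 - p k) c c'
   (fun k s => x k <= L + s%:Z) _ _ _ s0) //; last first.
- by move=> k t s kt; rewrite -ltNge => ks; rewrite /w lw0 // mulr0 mul0r.
- by move=> k t t' s k0; rewrite /w (lw_first _ _ _ _ (L + t'%:Z)) // k0.
rewrite /blocking_formula mulrA /K -big_split /=; congr (_ * _).
  by apply: eq_bigr => k _; rewrite exprSr; ring.
by rewrite -det_tr; congr (\det _); apply/matrixP => i j; rewrite !mxE.
Qed.

Hypothesis p01 : forall k, 0 < p k < 1.

Definition weightB (k : 'I_N) (xk xp zp zk : int) : R :=
  let block r := if (k == 0%N :> nat) then xk + r else Num.min (xk + r) zp in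
  (zk == block 0)%:R * (1 - p k) + (zk == block 1)%:R * p k.

(** At the barrier [xp] the whole geometric tail beyond the gap is collected, hence the missing
    factor [1 - p k]. *)
Definition weightC (k : 'I_N) (xk xp zp zk : int) : R :=
  if ((k != 0%N :> nat) && (zk == xp))%N then p k ^+ absz (xp - xk)
  else if (xk <= zk) && ((k == 0%N :> nat) || (zk < xp)) then (1 - p k) * p k ^+ absz (zk - xk)
  else 0.

(** Blocking shows only when coordinate k - 1 lands on t = x_k, and then coordinate k stays put with
    certainty. Since (1 - p_k)(1 + rho_k) = 1, this falls short of the free value by 1 - p_k times
    column k - 1 for n at t; hence the value -1 of [c']. *)
Lemma formulaB_step (s0 : 'I_M) (b : {ffun 'I_N -> 'I_M}) n :
  let x := box_state L b in
  (forall k, rho k = p k / (1 - p k)) ->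
  (forall n i j x, g n.+1 i j x = g n i j x + g n i j (x - 1)) ->
  W x -> (forall k, x k + 1 < L + M%:Z) ->
  \sum_(e : {ffun 'I_N -> 'I_M})
    step_weight (@Wb N)
      (fun k x z => weightB k (x k) (x (pred_ord k)) (z (pred_ord k)) (z k)) x (box_state L e) *
    blocking_formula n (box_state L e) =
  blocking_formula n.+1 x.
Proof.
move=> x rhoE g_rec Wx room.
pose V n := start_col n.
have rhoVp k : (rho k)^-1 * p k = 1 - p k.
  by rewrite rhoE; field; have := p01 k; lra.
have Vrec m k z : V m.+1 k z = V m k z + V m k (z + 1).
  apply/rowP => j; rewrite !mxE g_rec; congr (_ + g _ _ _ _); lia.
have xL k : L <= x k by have := box_state_bounds L b k; rewrite -/x; lia.
have Vpick m k c : L <= c < L + M%:Z ->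
    \sum_(s < M) (L + s%:Z == c)%:R *: V m k (L + s%:Z) = V m k c.
  by move=> cM; apply: (sum_box_pick (F := V m k)); lia.
have Wk (k : 'I_N) : x k <= x (pred_ord k) by apply: Wx; rewrite /= leq_pred.
apply: (blocking_formula_step s0 (c := fun=> 0)
  (c' := fun k t => if L + t%:Z == x k then -1 else 0)) => //.
- by move=> k xk xp zp zp' zk k0; rewrite /weightB k0.
- move=> k t z; rewrite -/x => kt zx; rewrite /weightB addr0.
  have [k0|k0] : k = 0%N :> nat \/ (0 < k)%N by lia.
    rewrite k0 /=; have -> : (z == x k) = false by lia.
    by have -> : (z == x k + 1) = false; [lia|rewrite !mul0r addr0].
  have tx := kt k0; have := Wk k => xx; rewrite gtn_eqF // !minEle.
  have -> : x k <= t by lia.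
  have -> : (z == x k) = false by lia.
  case: ifP => _; first by have -> : (z == x k + 1) = false; [lia|rewrite !mul0r addr0].
  by have -> : (z == t) = false; [lia|rewrite !mul0r addr0].
move=> k t kt; rewrite -/x; set X := x k.
have xr := room k; have xl := xL k; rewrite -/X in xr xl.
have free : (forall s : 'I_M, rho k ^ (X - (L + s%:Z)) *
       weightB k X (x (pred_ord k)) (L + t%:Z) (L + s%:Z) * ((0 < k)%N ==> (s <= t)%N)%:R =
      (1 - p k) * ((L + s%:Z == X)%:R + (L + s%:Z == X + 1)%:R)) ->
    \sum_(s < M) (rho k ^ (X - (L + s%:Z)) *
       weightB k X (x (pred_ord k)) (L + t%:Z) (L + s%:Z) *
       ((0 < k)%N ==> (s <= t)%N)%:R) *: V n k (L + s%:Z) = (1 - p k) *: V n.+1 k X.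
  move=> H; rewrite (eq_bigr (fun s : 'I_M =>
      (1 - p k) *: ((L + s%:Z == X)%:R *: V n k (L + s%:Z) +
        (L + s%:Z == X + 1)%:R *: V n k (L + s%:Z)))); last first.
    by move=> s _; rewrite H -scalerA; congr (_ *: _); rewrite scalerDl.
  by rewrite -scaler_sumr big_split /= !Vpick -?Vrec //; lia.
have wfree z : rho k ^ (X - z) * ((z == X)%:R * (1 - p k) + (z == X + 1)%:R * p k) =
    (1 - p k) * ((z == X)%:R + (z == X + 1)%:R).
  have [->|zX] := eqVneq z X.
    have -> : (X == X + 1) = false by lia.
    by rewrite subrr expr0z mul0r !addr0 !mul1r mulr1.
  have [->|_] := eqVneq z (X + 1); last by rewrite !mul0r !add0r !mulr0.
  by rewrite (_ : X - (X + 1) = -1) ?exprN1; [rewrite mul0r !add0r mul1r mulr1|lia].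
have [k0|k0] : k = 0%N :> nat \/ (0 < k)%N by lia.
  have k0' : (0 < k)%N = false by rewrite k0.
  rewrite [in RHS]k0' scale0r addr0; apply: free => s.
  by rewrite k0 /= mulr1 /weightB k0 /= addr0.
have tX : X <= L + t%:Z by apply: le_trans (Wk k) (kt k0).
have tsE (s : 'I_M) : ((0 < k)%N ==> (s <= t)%N) = (L + s%:Z <= L + t%:Z).
  by rewrite k0 lerD2l.
rewrite [in RHS]k0 scale1r scale0r add0r.
have [tE|tne] := eqVneq (L + t%:Z) X; last first.
  rewrite scale0r addr0; apply: free => s; rewrite tsE.
  move: (L + s%:Z) (L + t%:Z) tX tne => z t' tX tne.
  rewrite -wfree /weightB gtn_eqF // addr0 !minEle tX.
  have -> : X + 1 <= t' by lia.
  have [zt|tz] := leP z t'; first by rewrite mulr1.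
  have -> : (z == X) = false by lia.
  by have -> : (z == X + 1) = false; [lia|rewrite !(mul0r, addr0, mulr0)].
transitivity (\sum_(s < M) (L + s%:Z == X)%:R *: V n k (L + s%:Z)).
  apply: eq_bigr => s _; rewrite tsE tE; congr (_ *: _); move: (L + s%:Z) => z.
  rewrite /weightB gtn_eqF // addr0 !minEle lexx.
  have -> : (X + 1 <= X) = false by lia.
  have [->|zX] := eqVneq z X; last by rewrite !(mul0r, addr0, mulr0).
  by rewrite subrr expr0z lexx !mul1r mulr1 subrK.
rewrite Vpick; last by lia.
rewrite tE (start_col_pred _ _ k0) -/(V n) -/(V n.+1) Vrec.
move: (V n k X) (V n k (X + 1)) => v1 v2.
by apply/rowP => j; rewrite !mxE rhoE; field; have := p01 k; lra.
Qed.

(** The barrier is the old position A of coordinate k - 1, which its new position t cannot undercut;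
    the ordering is automatic, nothing depends on t and [c'] is 0. Column k for n at A, from the
    stopped mass, minus 1 - p_k times column k for n + 1 at A, from telescoping, is minus column k -
    1 for n + 1 at A; hence [c]. *)
Lemma formulaC_step (s0 : 'I_M) (b : {ffun 'I_N -> 'I_M}) n :
  let x := box_state L b in
  rho = p ->
  (forall n i j x, g n i j x = g n.+1 i j x - g n.+1 i j (x - 1)) ->
  (forall n (i j : 'I_N) x, (j <= i)%N -> x + i%:Z < j%:Z -> g n i j x = 0) ->
  (forall k, y' k < L + M%:Z) ->
  W x ->
  \sum_(e : {ffun 'I_N -> 'I_M})
    step_weight (@Wb N)
      (fun k x z => weightC k (x k) (x (pred_ord k)) (z (pred_ord k)) (z k)) x (box_state L e) *
    blocking_formula n (box_state L e) =
  blocking_formula n.+1 x.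
Proof.
move=> x rhoE g_rec g_low y'M Wx.
pose V n := start_col n.
have Vrec m k z : V m k z = V m.+1 k z - V m.+1 k (z + 1).
  apply/rowP => j; rewrite !mxE g_rec; congr (_ - g _ _ _ _); lia.
have xL k := box_state_bounds L b k.
have Vpick m k c : L <= c < L + M%:Z ->
    \sum_(s < M) (L + s%:Z == c)%:R *: V m k (L + s%:Z) = V m k c.
  by move=> cM; apply: (sum_box_pick (F := V m k)); lia.
have Vsum m k c : L <= c <= L + M%:Z ->
    \sum_(s < M) (L + s%:Z < c)%R%:R *: V m k (L + s%:Z) = V m.+1 k L - V m.+1 k c.
  move=> Lc; have := sum_box_telescope (fun z => - V m.+1 k z) Lc.
  rewrite opprK addrC => <-.
  by apply: eq_bigr => s _; congr (_ *: _); rewrite Vrec opprK [RHS]addrC.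
have Wk (k : 'I_N) : x k <= x (pred_ord k) by apply: Wx; rewrite /= leq_pred.
apply: (blocking_formula_step s0 (c := fun k => - (1 - p k)^-1) (c' := fun _ _ => 0)) => //.
- move=> k t z; rewrite -/x => kt zx; rewrite /weightC; have := Wk k => xx.
  have -> : (x k <= z) = false by lia.
  by have -> : (z == x (pred_ord k)) = false; [lia|rewrite andbF].
move=> k t kt; rewrite -/x; set X := x k.
have xl := xL k; rewrite -/x -/X in xl.
have p0 : p k != 0 by have := p01 k; lra.
have jump z : X <= z -> rho k ^ (X - z) * ((1 - p k) * p k ^+ absz (z - X)) = 1 - p k.
  move=> Xz; rewrite rhoE mulrCA exprz_absM // (_ : X - z + (z - X) = 0) ?mulr1 //; lia.
have [k0|k0] : k = 0%N :> nat \/ (0 < k)%N by lia.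
  have k0' : (0 < k)%N = false by rewrite k0.
  rewrite [in RHS]k0' scale0r addr0.
  transitivity (\sum_(s < M) (1 - p k) *: ((L + s%:Z < L + M%:Z)%R%:R *: V n k (L + s%:Z) -
     (L + s%:Z < X)%R%:R *: V n k (L + s%:Z))).
    apply: eq_bigr => s _; rewrite k0' /= mulr1 -scalerBl scalerA; congr (_ *: _).
    rewrite /weightC k0 /= andbT.
    have -> : L + s%:Z < L + M%:Z by have := ltn_ord s; lia.
    have [Xz|zX] := leP X (L + s%:Z); last by rewrite mulr0 subrr mulr0.
    by rewrite jump // subr0 mulr1.
  rewrite -scaler_sumr sumrB !Vsum; [|lia|lia].
  (* Coordinate 0 meets no barrier, so its sum is cut at the top of the box. The remainder is column
     0, all of it on or below the diagonal, at a point above [y']. *)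
  have -> : V n.+1 k (L + M%:Z) = 0.
    apply/rowP => i; rewrite !mxE g_low // k0 //.
    by have := y'M i; lia.
  by congr (_ *: _); rewrite subr0 opprB addrC subrK.
have tx := kt k0; have xx := Wk k; rewrite -/X in xx.
set A := x (pred_ord k) in tx xx *.
have Al := xL (pred_ord k); rewrite -/x -/A in Al.
rewrite [in RHS]k0 scale1r scale0r addr0.
pose q (c : int) (s : 'I_M) := (L + s%:Z < c)%R%:R *: V n k (L + s%:Z).
transitivity (\sum_(s < M) ((1 - p k) *: (q A s - q X s) +
    (L + s%:Z == A)%:R *: V n k (L + s%:Z))).
  apply: eq_bigr => s _; rewrite /q -scalerBl scalerA -scalerDl; congr (_ *: _).
  have -> : ((0 < k)%N ==> (s <= t)%N) = (L + s%:Z <= L + t%:Z) by rewrite k0 lerD2l.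
  move: (L + s%:Z) (L + t%:Z) tx => z t' tx.
  rewrite /weightC gtn_eqF //=.
  have [->|zA] := eqVneq z A.
    rewrite tx mulr1 ltxx (_ : (A < X) = false) ?subrr ?mulr0 ?add0r; last by lia.
    by rewrite rhoE exprz_absM // (_ : X - A + (A - X) = 0) //; lia.
  have [Xz|zX] := leP X z; last first.
    have -> : z < A by lia.
    by rewrite mulr0 mul0r subrr mulr0 addr0.
  rewrite subr0 addr0 /=; have [zA'|Az] := ltP z A; last by rewrite !mulr0 mul0r.
  by rewrite jump //; have -> : z <= t' by lia.
rewrite big_split /= -scaler_sumr sumrB !Vsum ?Vpick; [|lia|lia|lia].
rewrite (Vrec n k A) (start_col_pred _ _ k0) -/(V n.+1) rhoE.
move: (V n.+1 k A) (V n.+1 k (A + 1)) (V n.+1 k X) (V n.+1 k L) => v1 v2 v3 v4.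
by apply/rowP => j; rewrite !mxE; field; have := p01 k; lra.
Qed.

End BackwardEquation.

(** * The dynamics coordinate by coordinate *)

Section LocalDynamics.
Variable N : nat.
Implicit Types (x z : state N) (u : 'I_N -> nat).

(** The common signature, with both the old and the new position of coordinate k - 1, lets one
    [local_step] serve all four dynamics. *)
Definition posA (k : 'I_N) (r : nat) (xk xp zp : int) : int :=
  if (k == 0%N :> nat) then xk + r%:Z else Num.max xk zp + r%:Z.
Definition posB (k : 'I_N) (r : nat) (xk xp zp : int) : int :=
  if (k == 0%N :> nat) then xk + r%:Z else Num.min (xk + r%:Z) zp.
Definition posC (k : 'I_N) (r : nat) (xk xp zp : int) : int :=
  if (k == 0%N :> nat) then xk + r%:Z else Num.min (xk + r%:Z) xp.
Definition posD (k : 'I_N) (r : nat) (xk xp zp : int) : int :=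
  if (k == 0%N :> nat) then xk + r%:Z else Num.max (xk + r%:Z) zp.

Definition local_step (pos : 'I_N -> nat -> int -> int -> int -> int)
    (k : 'I_N) (r : nat) x z : bool :=
  z k == pos k r (x k) (x (pred_ord k)) (z (pred_ord k)).

Lemma local_step_fun pos u x z z' :
  (forall (k : 'I_N) r xk xp zp zp', k = 0%N :> nat -> pos k r xk xp zp = pos k r xk xp zp') ->
  (forall k, local_step pos k (u k) x z) -> (forall k, local_step pos k (u k) x z') -> z = z'.
Proof.
move=> pos0 Hz Hz'; apply/ffunP => k.
move: {2}(k : nat) (leqnn k) => n; elim: n k => [|n IH] k kn.
  have k0 : k = 0%N :> nat by lia.
  by rewrite (eqP (Hz k)) (eqP (Hz' k)); exact: pos0.
have [k0|k0] : k = 0%N :> nat \/ (0 < k)%N by lia.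
  by rewrite (eqP (Hz k)) (eqP (Hz' k)); exact: pos0.
by rewrite (eqP (Hz k)) (eqP (Hz' k)) (IH (pred_ord k)) //=; lia.
Qed.

Lemma step_pred_ord z (f : 'I_N -> int) (F : 'I_N -> 'I_N -> int) :
  ((forall k : 'I_N, k = 0%N :> nat -> z k = f k) /\
   (forall j k : 'I_N, k = j.+1 :> nat -> z k = F j k)) <->
  forall k : 'I_N, z k == if (k == 0%N :> nat) then f k else F (pred_ord k) k.
Proof.
split=> [[H0 HS] k|H]; last first.
  split=> [k k0|j k kj]; have /eqP -> := H k; first by rewrite k0.
  rewrite kj /=; congr (F _ k); apply: val_inj => /=; by rewrite kj.
apply/eqP; case: eqP => k0; first exact: H0.
by apply: HS => /=; lia.
Qed.

Lemma stepAE u x z : stepA u x z <-> forall k, local_step posA k (u k) x z.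
Proof. exact: (step_pred_ord z _ (fun j k => Num.max (x k) (z j) + (u k)%:Z)). Qed.

Lemma stepBE u x z : stepB u x z <-> forall k, local_step posB k (u k) x z.
Proof. exact: (step_pred_ord z _ (fun j k => Num.min (x k + (u k)%:Z) (z j))). Qed.

Lemma stepCE u x z : stepC u x z <-> forall k, local_step posC k (u k) x z.
Proof. exact: (step_pred_ord z _ (fun j k => Num.min (x k + (u k)%:Z) (x j))). Qed.

Lemma stepDE u x z : stepD u x z <-> forall k, local_step posD k (u k) x z.
Proof. exact: (step_pred_ord z _ (fun j k => Num.max (x k + (u k)%:Z) (z j))). Qed.

Lemma stepA_fun u x z z' : stepA u x z -> stepA u x z' -> z = z'.
Proof.
move=> /stepAE H /stepAE; apply: (local_step_fun _ H) => k r xk xp zp zp' k0.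
by rewrite /posA k0.
Qed.

Lemma stepB_fun u x z z' : stepB u x z -> stepB u x z' -> z = z'.
Proof.
move=> /stepBE H /stepBE; apply: (local_step_fun _ H) => k r xk xp zp zp' k0.
by rewrite /posB k0.
Qed.

Lemma stepC_fun u x z z' : stepC u x z -> stepC u x z' -> z = z'.
Proof.
by move=> /stepCE H /stepCE; apply: (local_step_fun _ H).
Qed.

Lemma stepD_fun u x z z' : stepD u x z -> stepD u x z' -> z = z'.
Proof.
move=> /stepDE H /stepDE; apply: (local_step_fun _ H) => k r xk xp zp zp' k0.
by rewrite /posD k0.
Qed.

Lemma stepA_mono u x z : Whatb x -> stepA u x z -> Whatb z /\ forall k, x k <= z k.
Proof.
move=> _ /stepAE H; split=> [|k].
  apply/forallP => k; apply/implyP => k0.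
  by have := H k; rewrite /local_step /posA gtn_eqF //; lia.
by have := H k; rewrite /local_step /posA; case: ifP; lia.
Qed.

Lemma stepD_mono u x z : Whatb x -> stepD u x z -> Whatb z /\ forall k, x k <= z k.
Proof.
move=> _ /stepDE H; split=> [|k].
  apply/forallP => k; apply/implyP => k0.
  by have := H k; rewrite /local_step /posD gtn_eqF //; lia.
by have := H k; rewrite /local_step /posD; case: ifP; lia.
Qed.

(** A barrier at z_{k-1} could lower coordinate k only from below x_k; induction on k excludes this
    through z_{k-1} >= x_{k-1} >= x_k. *)
Lemma stepB_mono u x z : Wb x -> stepB u x z -> Wb z /\ forall k, x k <= z k.
Proof.
move=> /forallP Wx /stepBE H; split=> [|k].
  apply/forallP => k; apply/implyP => k0.
  by have := H k; rewrite /local_step /posB gtn_eqF //; lia.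
move: {2}(k : nat) (leqnn k) => n; elim: n k => [|n IH] k kn.
  by have := H k; rewrite /local_step /posB (_ : (k == 0%N :> nat)) //; lia.
have := H k; rewrite /local_step /posB; case: ifP => k0; first by lia.
have := IH (pred_ord k); have := Wx k; rewrite lt0n k0 /=; lia.
Qed.

Lemma stepC_mono u x z : Wb x -> stepC u x z -> Wb z /\ forall k, x k <= z k.
Proof.
move=> /forallP Wx /stepCE H.
have mono k : x k <= z k.
  have := H k; rewrite /local_step /posC; case: ifP => k0; first by lia.
  by have := Wx k; rewrite lt0n k0 /=; lia.
split=> //; apply/forallP => k; apply/implyP => k0.
by have := H k; have := mono (pred_ord k); rewrite /local_step /posC gtn_eqF //; lia.
Qed.

End LocalDynamics.

(** * One-step laws of single coordinates *)

Section LocalWeights.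
Context d (T : measurableType d) (R : realType) (P : probability T R) (N : nat).
Variables (p : 'I_N -> R) (xi : 'I_N -> nat -> {RV P >-> nat}).
Implicit Types (x z : state N).

Lemma geometric_weightA k m x z : geometric_noise p xi -> (1 <= m)%N ->
  P (xi k m @^-1` [set r | local_step (@posA N) k r x z]) =
  (weightA p k (x k) (z (pred_ord k)) (z k))%:E.
Proof.
move=> geo m1; rewrite /weightA; set lo : int := if _ then _ else _.
have locE r : local_step (@posA N) k r x z = (z k == lo + r%:Z).
  by rewrite /local_step /posA /lo; case: ifP.
case: ifP => loz.
  rewrite -(geo k m m1); congr (P _); apply/seteqP; split=> t /=; rewrite locE; lia.
rewrite (_ : _ @^-1` _ = set0) ?measure0 //; apply/seteqP; split=> t //=; rewrite locE; lia.
Qed.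

Lemma geometric_weightC k m x z : geometric_noise p xi -> (1 <= m)%N -> Wb x -> Wb z ->
  P (xi k m @^-1` [set r | local_step (@posC N) k r x z]) =
  (weightC p k (x k) (x (pred_ord k)) (z (pred_ord k)) (z k))%:E.
Proof.
move=> geo m1 /forallP Wx _; rewrite /weightC /local_step /posC; have := Wx k; rewrite lt0n.
case: eqP => /= k0 xx.
  rewrite andbT; case: ifP => loz.
    rewrite -(geo k m m1); congr (P _); apply/seteqP; split=> t /=; lia.
  rewrite (_ : _ @^-1` _ = set0) ?measure0 //; apply/seteqP; split=> t //=; lia.
have [zx|zx] := eqVneq (z k) (x (pred_ord k)).
  rewrite -(geometric_tail _ (geo k m m1)); congr (P _); apply/seteqP; split=> t /=; lia.
case: ifP => loz.
  rewrite -(geo k m m1); congr (P _); apply/seteqP; split=> t /=; lia.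
rewrite (_ : _ @^-1` _ = set0) ?measure0 //; apply/seteqP; split=> t //=; lia.
Qed.

Lemma bernoulli_weightB k m x z : bernoulli_noise p xi -> (1 <= m)%N ->
  P (xi k m @^-1` [set r | local_step (@posB N) k r x z]) =
  (weightB p k (x k) (x (pred_ord k)) (z (pred_ord k)) (z k))%:E.
Proof. by move=> ber m1; have [P1 P0] := ber k m m1; rewrite (bernoulli_preimage _ P1 P0). Qed.

Lemma bernoulli_weightD k m x z : bernoulli_noise p xi -> (1 <= m)%N ->
  P (xi k m @^-1` [set r | local_step (@posD N) k r x z]) =
  (weightD p k (x k) (z (pred_ord k)) (z k))%:E.
Proof. by move=> ber m1; have [P1 P0] := ber k m m1; rewrite (bernoulli_preimage _ P1 P0). Qed.

End LocalWeights.

(** * Identifying the kernel from its recursion and initial value *)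

Section KernelFormulas.
Context (R : realType) (N M : nat) (L : int).
Variables (S : pred (state N)) (wt : 'I_N -> state N -> state N -> R).
Let J := {ffun 'I_N -> 'I_M}.
Let box (b : J) := box_state L b.

Lemma step_weights_forward (b0 : J) (F : nat -> state N -> R) :
  S (box b0) ->
  (forall b, S (box b) -> F 0%N (box b) = (b0 == b)%:R) ->
  (forall n b, S (box b) ->
    \sum_(e : J) F n (box e) * step_weight S wt (box e) (box b) = F n.+1 (box b)) ->
  forall n b, S (box b) -> step_weights S wt box n b0 b = F n (box b).
Proof.
move=> Sb0 F0 FS; elim=> [|n IH] b Sb; first by rewrite F0.
rewrite -FS //=; apply: eq_bigr => e _; rewrite /step_weight.
by case: ifP => [/andP[Se _]|_]; [rewrite IH|rewrite !mulr0].
Qed.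

(* [room] is needed in case B: [start_col] does not vanish far above [y'], so the
   box must contain every state within [n] steps of the current one. *)
Lemma step_weights_backward (b1 : J) (room : nat -> J -> bool) (F : nat -> state N -> R) :
  S (box b1) ->
  (forall b, S (box b) -> F 0%N (box b) = (b == b1)%:R) ->
  (forall n b e, room n.+1 b -> step_weight S wt (box b) (box e) != 0 -> room n e) ->
  (forall n b, S (box b) -> room n.+1 b ->
    \sum_(e : J) step_weight S wt (box b) (box e) * F n (box e) = F n.+1 (box b)) ->
  forall n b, S (box b) -> room n b -> step_weights S wt box n b b1 = F n (box b).
Proof.
move=> Sb1 F0 roomS FS; elim=> [|n IH] b Sb rb; first by rewrite F0.
rewrite -FS // step_weightsSl; apply: eq_bigr => e _.
have [->|nz] := eqVneq (step_weight S wt (box b) (box e)) 0; first by rewrite !mul0r.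
have re := roomS _ _ _ rb nz.
rewrite IH //; move: nz; rewrite /step_weight; case: ifP => [/andP[]//|_].
by rewrite eqxx.
Qed.

End KernelFormulas.

(** * The formulas at time zero *)

Section InitialDeterminants.
Context (R : realType) (N : nat) (a : 'I_N -> R) (f : int -> R).
Hypothesis f0 : forall x, f x = (x == 0)%:R.
Implicit Types (y : state N).

Let fN x : x != 0 -> f x = 0. Proof. by rewrite f0 => /negPf ->. Qed.

Lemma det_transf_initial y y' : W y -> W y' ->
  \det (\matrix_(i < N, j < N) transf f a i j (y' i - y j - i%:Z + j%:Z)) = (y == y')%:R.
Proof.
apply: det_initial => [i x|i j x x0|i j x ji xij]; first by rewrite transfxx f0.
  by apply: transf_high => // z z0; apply: fN; lia.
by apply: transf_low => // z z0; apply: fN; lia.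
Qed.

(** Negating all coordinates exchanges [What] with [W] and, by [transhat_transf], reduces to the
    unhatted entries. *)
Lemma det_transhat_initial y y' : What y -> What y' ->
  \det (\matrix_(i < N, j < N) transhat f a i j (y' i - y j + i%:Z - j%:Z)) = (y == y')%:R.
Proof.
move=> Wy Wy'; pose opp (z : state N) : state N := [ffun k => - z k].
have -> : (y == y') = (opp y == opp y').
  apply/eqP/eqP => [->//|/ffunP E]; apply/ffunP => k.
  by have := E k; rewrite !ffunE => /oppr_inj.
have Wopp z : What z -> W (opp z).
  by move=> Wz j k jk; rewrite !ffunE lerN2; exact: Wz.
rewrite -(@det_initial _ _ (transf (fun x => f (- x)) a) (opp y) (opp y')); last 2 first.
- exact: Wopp.
- exact: Wopp.
- congr (\det _); apply/matrixP => i j; rewrite !mxE !ffunE transhat_transf.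
  by congr (transf _ _ _ _ _); lia.
- by move=> i x; rewrite transfxx f0 oppr_eq0.
- by move=> i j x x0; apply: transf_high => // z z0; apply: fN; lia.
by move=> i j x ji xij; apply: transf_low => // z z0; apply: fN; lia.
Qed.

End InitialDeterminants.

Lemma box_exists N (y y' : state N) (n : nat) : (0 < N)%N ->
  exists (L : int) (M : nat) (s0 : 'I_M) (b b' : {ffun 'I_N -> 'I_M}),
  [/\ box_state L b = y, box_state L b' = y', forall k, L + N%:Z <= y k &
      forall k, y k + n%:Z < L + M%:Z].
Proof.
(* The box is [-A, A]; the summand [N] provides the margin below [y], and [n] the room above it. *)
move=> N_gt0; pose A := (\sum_k (absz (y k) + absz (y' k)) + N + n)%N.
have H k : (absz (y k) + absz (y' k) + N + n <= A)%N.
  by rewrite /A (bigD1 k) //= !leq_add2r leq_addr.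
have [|b bE] := @box_stateP N (A + A).+1 (- A%:Z) y; first by move=> k; have := H k; lia.
have [|b' bE'] := @box_stateP N (A + A).+1 (- A%:Z) y'; first by move=> k; have := H k; lia.
by exists (- A%:Z), (A + A).+1, ord0, b, b'; split=> // k; have := H k; lia.
Qed.

(** * The four transition kernels *)

Section Cases.
Context (R : realType) (N : nat) (p : 'I_N -> R).
Hypothesis N_gt0 : (1 <= N)%N.
Hypothesis p01 : forall k, 0 < p k < 1.
Context d (T : measurableType d) (P : probability T R).
Variables (xi : 'I_N -> nat -> {RV P >-> nat}) (Y : nat -> T -> state N).
Variables (n : nat) (y y' : state N).
Hypothesis y_charged : P [set t | Y 0%N t = y] != 0%E.

Let p0 k : p k != 0. Proof. by have := p01 k; lra. Qed.
Let odds k := p k / (1 - p k).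
Let odds0 k : odds k != 0.
Proof. by rewrite mulf_neq0 // invr_eq0; have := p01 k; lra. Qed.

Let transhat_row (f : nat -> int -> R) (al : 'I_N -> R) : (forall n x, x < 0 -> f n x = 0) ->
  forall n (i j : 'I_N) x, (0 < i)%N ->
  transhat (f n) al i j x =
  transhat (f n) al (pred_ord i) j x - al i * transhat (f n) al (pred_ord i) j (x - 1).
Proof.
move=> f_lt0 m i j x i0; rewrite !transhat_transf transf_row //; last first.
  by apply: (@summable_with_bounded _ _ _ _ 0) => z z0; apply: f_lt0; lia.
by rewrite (_ : - (x - 1) = - x + 1) //; lia.
Qed.

Let transhat_low (f : nat -> int -> R) (al : 'I_N -> R) : (forall n x, x < 0 -> f n x = 0) ->
  forall n i j x, x < 0 -> transhat (f n) al i j x = 0.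
Proof.
move=> f_lt0 m i j x x0; rewrite transhat_transf; apply: transf_high; last by lia.
by move=> z z0; apply: f_lt0; lia.
Qed.

Let transhat_rec (f : nat -> int -> R) (al : 'I_N -> R) m m' s :
  (forall n x, x < 0 -> f n x = 0) ->
  (forall x, f m' x = f m x + s * f m (x - 1)) ->
  forall i j x, transhat (f m') al i j x =
    transhat (f m) al i j x + s * transhat (f m) al i j (x - 1).
Proof.
move=> f_lt0 frec i j x; rewrite !transhat_transf.
rewrite (_ : - (x - 1) = - x + 1); last by lia.
apply: transf_rec => [z|]; first by rewrite frec opprD.
by apply: (@summable_with_bounded _ _ _ _ 0) => z z0; apply: f_lt0; lia.
Qed.

Let isSP (S : state N -> Prop) (Sb : pred (state N)) step :
  (forall z, reflect (S z) (Sb z)) -> is_chain S step xi Y ->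
  is_chain (fun z => Sb z) step xi Y.
Proof. by move=> SP [Y0 mY0 indep Yst]; split=> // t; apply/SP. Qed.

Let weight_initial (rho : 'I_N -> R) (z z' : state N) :
  \prod_k ((1 - p k) ^+ 0 * rho k ^ (z' k - z k)) * (z == z')%:R = (z == z')%:R.
Proof.
have [->|_] := eqVneq z z'; last by rewrite mulr0.
by rewrite mulr1 big1 // => k _; rewrite subrr expr0z mulr1.
Qed.

Lemma transitionA : geometric_noise p xi -> is_chain (@What N) (@stepA N) xi Y ->
  What y -> What y' ->
  transition P Y n y y' =
  hat_formula y p p (fun n => transhat (wfun R n) (fun k => (p k)^-1)) n y'.
Proof.
move=> geo /(isSP (@WhatP N)) chain Wy Wy'.
have [L [M [s0 [b0 [b [b0E bE yl yh]]]]]] := box_exists y y' n N_gt0.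
rewrite -b0E -bE (transition_box_kernel (@stepAE N) (@stepA_mono N) (@stepA_fun N)
  (wt := fun k x z => weightA p k (x k) (z (pred_ord k)) (z k)) _ chain) ?b0E //; last first.
  by move=> k m x z m1 _ _; exact: geometric_weightA.
pose g m := transhat (wfun R m) (fun k => (p k)^-1).
have wneg m x : x < 0 -> wfun R m x = 0 by exact: wfun_lt0.
rewrite (step_weights_forward (F := hat_formula y p p g)) ?bE //; last 1 first.
- by apply/WhatP; rewrite ?bE.
- by apply/WhatP; rewrite ?b0E.
- move=> e /WhatP We; rewrite /hat_formula det_transhat_initial //; last exact: wfun0.
  by rewrite weight_initial -b0E (inj_eq (@box_state_inj _ _ _)).
move=> m e /WhatP We; apply: (formulaA_step p01 yl _ s0) => //.
- by move=> m' i j x; exact: transhat_low.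
- by move=> m' i j x; exact: transhat_row.
move=> m' i j x.
have H z : wfun R m' z = wfun R m'.+1 z + -1 * wfun R m'.+1 (z - 1).
  by rewrite mulN1r; exact: wfun_rec.
by rewrite /g (transhat_rec _ wneg H) mulN1r.
Qed.

Lemma transitionD : bernoulli_noise p xi -> is_chain (@What N) (@stepD N) xi Y ->
  What y -> What y' ->
  transition P Y n y y' =
  hat_formula y p odds (fun n => transhat (vfun R n) (fun k => (odds k)^-1)) n y'.
Proof.
move=> ber /(isSP (@WhatP N)) chain Wy Wy'.
have [L [M [s0 [b0 [b [b0E bE yl yh]]]]]] := box_exists y y' n N_gt0.
rewrite -b0E -bE (transition_box_kernel (@stepDE N) (@stepD_mono N) (@stepD_fun N)
  (wt := fun k x z => weightD p k (x k) (z (pred_ord k)) (z k)) _ chain) ?b0E //; last first.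
  by move=> k m x z m1 _ _; exact: bernoulli_weightD.
pose g m := transhat (vfun R m) (fun k => (odds k)^-1).
have vneg m x : x < 0 -> vfun R m x = 0 by exact: vfun_lt0.
rewrite (step_weights_forward (F := hat_formula y p odds g)) ?bE //; last 1 first.
- by apply/WhatP; rewrite ?bE.
- by apply/WhatP; rewrite ?b0E.
- move=> e /WhatP We; rewrite /hat_formula det_transhat_initial //; last exact: vfun0.
  by rewrite weight_initial -b0E (inj_eq (@box_state_inj _ _ _)).
move=> m e /WhatP We; apply: (formulaD_step p01 yl _ s0) => //.
- by move=> m' i j x; exact: transhat_low.
- by move=> m' i j x; exact: transhat_row.
move=> m' i j x.
have H z : vfun R m'.+1 z = vfun R m' z + 1 * vfun R m' (z - 1).
  by rewrite mul1r; exact: vfun_rec.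
by rewrite /g (transhat_rec _ vneg H) mul1r.
Qed.

Lemma transitionB : bernoulli_noise p xi -> is_chain (@W N) (@stepB N) xi Y ->
  W y -> W y' ->
  transition P Y n y y' = blocking_formula y' p odds (fun n => transf (vfun R n) odds) n y.
Proof.
move=> ber /(isSP (@WP N)) chain Wy Wy'.
have [L [M [s0 [b0 [b [b0E bE yl yh]]]]]] := box_exists y y' n N_gt0.
rewrite -b0E -bE (transition_box_kernel (@stepBE N) (@stepB_mono N) (@stepB_fun N)
  (wt := fun k x z => weightB p k (x k) (x (pred_ord k)) (z (pred_ord k)) (z k)) _ chain)
  ?b0E //; last first.
  by move=> k m x z m1 _ _; exact: bernoulli_weightB.
pose g m := transf (vfun R m) odds.
have sv m : summable_with odds (vfun R m).
  by apply: (@summable_with_bounded _ _ _ _ m%:Z) => z; exact: vfun_gt.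
rewrite (step_weights_backward
  (room := fun m e => [forall k, box_state L e k + m%:Z < L + M%:Z])
  (F := blocking_formula y' p odds g)) ?b0E ?bE //.
- by apply/WP; rewrite ?bE.
- move=> e /WP We; rewrite /blocking_formula det_transf_initial //; last exact: vfun0.
  by rewrite weight_initial -bE (inj_eq (@box_state_inj _ _ _)).
(* A Bernoulli step raises a coordinate by at most one, so one unit of room per remaining step
   suffices. *)
- move=> m c e /forallP rc nz; apply/forallP => k; have := rc k.
  suff : box_state L e k <= box_state L c k + 1 by lia.
  rewrite leNgt; apply: contra_neqN nz => ck; rewrite /step_weight; case: ifP => // _.
  rewrite (bigD1 k) //= /weightB; set u0 := (_ == _); set u1 := (_ == _).
  have -> : u0 = false by apply/negP => /eqP; case: ifP => _; lia.
  have -> : u1 = false by apply/negP => /eqP; case: ifP => _; lia.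
  by rewrite !mul0r addr0 mul0r.
- move=> m e /WP We /forallP re; apply: (formulaB_step y' odds0 _ p01 s0) => //.
  + by move=> m' i j x j0; exact: transf_col.
  + move=> m' i j x.
    have H z : vfun R m'.+1 z = vfun R m' z + 1 * vfun R m' (z - 1).
      by rewrite mul1r; exact: vfun_rec.
    by rewrite /g (transf_rec _ _ _ H) // mul1r.
  + by move=> k; have := re k; lia.
- by apply/WP; rewrite ?b0E.
- by apply/forallP => k; rewrite ?b0E.
Qed.

Lemma transitionC : geometric_noise p xi -> is_chain (@W N) (@stepC N) xi Y ->
  W y -> W y' ->
  transition P Y n y y' = blocking_formula y' p p (fun n => transf (wfun R n) p) n y.
Proof.
move=> geo /(isSP (@WP N)) chain Wy Wy'.
have [L [M [s0 [b0 [b [b0E bE yl yh]]]]]] := box_exists y y' n N_gt0.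
rewrite -b0E -bE (transition_box_kernel (@stepCE N) (@stepC_mono N) (@stepC_fun N)
  (wt := fun k x z => weightC p k (x k) (x (pred_ord k)) (z (pred_ord k)) (z k)) _ chain)
  ?b0E //; last first.
  by move=> k m x z m1; exact: geometric_weightC.
pose g m := transf (wfun R m) p.
have sw m : summable_with p (wfun R m) by exact: summable_with_wfun.
(* The top of the box costs nothing: coordinates k > 0 stop at the old position of coordinate k - 1,
   and column 0 vanishes above [y']. *)
rewrite (step_weights_backward (room := fun _ _ => true)
  (F := blocking_formula y' p p g)) ?b0E ?bE //.
- by apply/WP; rewrite ?bE.
- move=> e /WP We; rewrite /blocking_formula det_transf_initial //; last exact: wfun0.
  by rewrite weight_initial -bE (inj_eq (@box_state_inj _ _ _)).
- move=> m e /WP We _; apply: (formulaC_step p0 _ p01 s0) => //.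
  + by move=> m' i j x j0; exact: transf_col.
  + move=> m' i j x.
    have H z : wfun R m' z = wfun R m'.+1 z + -1 * wfun R m'.+1 (z - 1).
      by rewrite mulN1r; exact: wfun_rec.
    by rewrite /g (transf_rec _ _ _ H) // mulN1r.
  + by move=> m' i j x; apply: transf_low => z; exact: wfun_lt0.
  + by move=> k; rewrite -bE; have := box_state_bounds L b k; lia.
- by apply/WP; rewrite ?b0E.
Qed.

End Cases.

Theorem theorem1 (R : realType) (N : nat) (hN : (1 <= N)%N)
    (p : 'I_N -> R) (hp : forall k, 0 < p k < 1)
    (d : measure_display) (T : measurableType d) (P : probability T R)
    (xi : 'I_N -> nat -> {RV P >-> nat}) (Y : nat -> T -> state N)
    (n : nat) (y y' : state N) (hy : P [set t | Y 0%N t = y] != 0%E) :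
  let p_inv := fun k => (p k)^-1 in
  let pi_ := fun k => p k / (1 - p k) in
  let pi_inv := fun k => (pi_ k)^-1 in
  [/\ geometric_noise p xi -> is_chain (@What N) (@stepA N) xi Y ->
      What y -> What y' ->
      transition P Y n y y' =
        (\prod_(k < N) ((1 - p k) ^+ n * p k ^ (y' k - y k))) *
        \det (\matrix_(i < N, j < N)
          transhat (wfun R n) p_inv i j (y' i - y j + i%:Z - j%:Z)),
      bernoulli_noise p xi -> is_chain (@W N) (@stepB N) xi Y ->
      W y -> W y' ->
      transition P Y n y y' =
        (\prod_(k < N) ((1 - p k) ^+ n * pi_ k ^ (y' k - y k))) *
        \det (\matrix_(i < N, j < N)
          transf (vfun R n) pi_ i j (y' i - y j - i%:Z + j%:Z)),
      geometric_noise p xi -> is_chain (@W N) (@stepC N) xi Y ->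
      W y -> W y' ->
      transition P Y n y y' =
        (\prod_(k < N) ((1 - p k) ^+ n * p k ^ (y' k - y k))) *
        \det (\matrix_(i < N, j < N)
          transf (wfun R n) p i j (y' i - y j - i%:Z + j%:Z)) &
      bernoulli_noise p xi -> is_chain (@What N) (@stepD N) xi Y ->
      What y -> What y' ->
      transition P Y n y y' =
        (\prod_(k < N) ((1 - p k) ^+ n * pi_ k ^ (y' k - y k))) *
        \det (\matrix_(i < N, j < N)
          transhat (vfun R n) pi_inv i j (y' i - y j + i%:Z - j%:Z))].
Proof.
move=> p_inv pi_ pi_inv; split=> noise chain Wy Wy'.
- exact: (transitionA hN hp n hy noise chain Wy Wy').
- exact: (transitionB hN hp n hy noise chain Wy Wy').
- exact: (transitionC hN hp n hy noise chain Wy Wy').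
- exact: (transitionD hN hp n hy noise chain Wy Wy').
Qed.
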